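(* Let $k$ be a field of characteristic zero and $d\ge 4$ a natural number. Then there exists an affine Poisson $k$-algebra of Krull dimension $d$ such that $(0)$ is Poisson rational but not Poisson locally closed.
   Context: A Poisson $k$-algebra is a commutative $k$-algebra $A$ with a $k$-bilinear Lie bracket $\{-,-\}$ such that $\{-,x\}$ is a derivation for each $x\in A$. Affine means finitely generated over $k$ and an integral domain. A Poisson ideal is an ideal $I$ with $\{I,A\}\subseteq I$; a Poisson prime is a prime Poisson ideal. A Poisson prime $P$ is Poisson locally closed if $\{P\}$ is locally closed in the set of Poisson primes with the relative Zariski topology (equivalently, the intersection of all Poisson primes strictly containing $P$ strictly contains $P$). $P$ is Poisson rational if the Poisson centre $\{z:\{z,-\}\equiv0\}$ of $\operatorname{Frac}(A/P)$ is algebraic over $k$. *)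

(* Defs.v *)
From HB Require Import structures.
From mathcomp Require Import all_boot all_order all_algebra.
From mathcomp Require Import mpoly.
Set Implicit Arguments. Unset Strict Implicit. Unset Printing Implicit Defensive.
Import Order.TTheory GRing.Theory.
Local Open Scope ring_scope.

(* A commutative k-algebra A is represented by an idomainType A (commutative,
   integral domain) together with its structure map iota : k -> A
   (a ring morphism).  Subsets/ideals of A are predicates A -> Prop. *)

Local Notation "x %:F" := (@FracField.tofrac _ x).

Section PoissonDefs.
Variables (k : fieldType) (A : idomainType) (iota : {rmorphism k -> A}).

Definition finitely_generated : Prop :=
  exists (n : nat) (g : 'I_n -> A),
    forall a : A, exists p : {mpoly k[n]}, a = mmap iota g p.

Definition is_poisson_bracket (br : A -> A -> A) : Prop :=
  (forall x y z, br (x + y) z = br x z + br y z) /\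
  (forall x y z, br x (y + z) = br x y + br x z) /\
  (forall (c : k) x y, br (iota c * x) y = iota c * br x y) /\
  (forall (c : k) x y, br x (iota c * y) = iota c * br x y) /\
  (forall x, br x x = 0) /\
  (forall x y z, br x (br y z) + br y (br z x) + br z (br x y) = 0) /\
  (forall x y z, br (y * z) x = y * br z x + br y x * z).

Definition is_ideal (I : A -> Prop) : Prop :=
  [/\ I 0, (forall x y, I x -> I y -> I (x + y)) & (forall a x, I x -> I (a * x))].

Definition is_prime_ideal (I : A -> Prop) : Prop :=
  [/\ is_ideal I, ~ I 1 & (forall x y, I (x * y) -> I x \/ I y)].

Definition is_poisson_ideal (br : A -> A -> A) (I : A -> Prop) : Prop :=
  is_ideal I /\ (forall x a, I x -> I (br x a)).

Definition is_poisson_prime (br : A -> A -> A) (I : A -> Prop) : Prop :=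
  is_prime_ideal I /\ is_poisson_ideal br I.

Definition same_set (I J : A -> Prop) : Prop := forall x, I x <-> J x.
Definition sub_set (I J : A -> Prop) : Prop := forall x, I x -> J x.

(* {P} is locally closed in the set of Poisson primes with the relative
   Zariski topology: {P} = V(S) \cap (complement of V(T)) within the
   Poisson primes, for some subsets S, T of A
   (closed sets are V(S) = {Q | S \subseteq Q}). *)
Definition poisson_locally_closed (br : A -> A -> A) (P : A -> Prop) : Prop :=
  exists S T : A -> Prop,
    forall Q, is_poisson_prime br Q ->
      (same_set Q P <-> (sub_set S Q /\ ~ sub_set T Q)).

Definition prime_chain (n : nat) (P : nat -> A -> Prop) : Prop :=
  (forall i, (i <= n)%N -> is_prime_ideal (P i)) /\
  (forall i, (i < n)%N -> sub_set (P i) (P i.+1) /\ ~ sub_set (P i.+1) (P i)).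

Definition krull_dim_eq (d : nat) : Prop :=
  (exists P, prime_chain d P) /\ ~ (exists P, prime_chain d.+1 P).

(* The Poisson bracket extended to Frac(A) (by the quotient rule):
   {a/b, c/d} = ((({a,c} d - c {a,d}) b - a ({b,c} d - c {b,d})) / (b^2 d^2). *)
Definition frac_bracket_formula (br : A -> A -> A) (a b c d : A)
  : {fraction A} :=
  (((br a c * d - c * br a d) * b - a * (br b c * d - c * br b d))%:F)
    / ((b ^+ 2 * d ^+ 2)%:F).

Definition frac_poisson_central (br : A -> A -> A) (z : {fraction A}) : Prop :=
  forall a b c d : A, b != 0 -> d != 0 -> z = a%:F / b%:F ->
    frac_bracket_formula br a b c d = 0.

Definition frac_algebraic (z : {fraction A}) : Prop :=
  exists q : {poly k}, q != 0 /\
    (map_poly (fun c => (iota c)%:F) q).[z] = 0.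

(* (0) is Poisson rational: the Poisson centre of Frac(A/(0)) = Frac(A)
   is algebraic over k. *)
Definition zero_poisson_rational (br : A -> A -> A) : Prop :=
  forall z : {fraction A}, frac_poisson_central br z -> frac_algebraic z.

End PoissonDefs.

(* Main.v *)
(** Let [B = k[x, y, w]] carry the derivation [delta] whose leaves are the horizontal
    sections of the universal vector extension of the elliptic curves
    [x y z = t], [x + y + z = 1]. Its leaves through torsion points are algebraic
    curves, and they are Zariski dense. On the other hand [delta] has no
    nonconstant rational first integral. Indeed [t = 0] is a triangle of lines; at
    a corner the two adjacent edges are invariant with the eigenvalues [1 + w] and
    [1 - w], and comparing the orders of vanishing along the two edges shows that
    a first integral restricts to a rational function [phi(w)] at the corner.
    Transport along an edge shifts [w] by [2], so that [phi] has period [6] and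
    is constant.

    Adjoining [d - 3] variables that are eigenvectors of eigenvalues
    [w^2, w^3, ...] gives a derivation [D] of the polynomial ring in [d] variables
    which still has no new constants, and [{f, g} = D f * E g - E f * D g], with [E] the Euler
    derivation of the last variable, is the required Poisson bracket: a Poisson
    central fraction is a constant of [D], and the kernels attached to the torsion leaves
    are nonzero Poisson primes with zero intersection.

    The algebraicity of the leaves is obtained from formal solutions
    [x ~ - s^j, y ~ - s^(2M - j)] with [M = 2^n]: doubling takes the solution [j] to
    the solution [2 j] by uniqueness, and for [j = M] uniqueness and symmetry give
    [x = y]. *)

Require Import Defs.
From HB Require Import structures.
From mathcomp Require Import all_boot all_order all_algebra.
From mathcomp Require Import mpoly.
From mathcomp Require Import boolp ring zify.
Set Implicit Arguments. Unset Strict Implicit. Unset Printing Implicit Defensive.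
Import GRing.Theory.
Local Open Scope ring_scope.

(** * Krull dimension *)

Section AlgebraicIndependence.
Variable k : fieldType.

Definition ext_fun (S : Type) r (g : 'I_r -> S) (h : S) (i : 'I_r.+1) : S :=
  if unlift ord_max i is Some j then g j else h.

Lemma ext_fun_max (S : Type) r (g : 'I_r -> S) h : ext_fun g h ord_max = h.
Proof. by rewrite /ext_fun unlift_none. Qed.

Lemma ext_fun_widen (S : Type) r (g : 'I_r -> S) h (i : 'I_r) :
  ext_fun g h (widen_ord (leqnSn r) i) = g i.
Proof.
rewrite /ext_fun; have -> : widen_ord (leqnSn r) i = lift ord_max i.
  by apply: val_inj; rewrite /= /bump leqNgt ltn_ord.
by rewrite liftK.
Qed.

(** [muni] isolates the last variable, so a relation involving the added element [h] becomes a
    univariate polynomial with [h] as a root. *)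
Lemma mmap_ext_fun (S : comNzRingType) (f : {rmorphism k -> S}) r
    (g : 'I_r -> S) (h : S) (p : {mpoly k[r.+1]}) :
  mmap f (ext_fun g h) p = (map_poly (mmap f g) (muni p)).[h].
Proof.
rewrite muniE rmorph_sum /= horner_sum; apply: eq_bigr => m _.
rewrite -mul_polyC rmorphM /= map_polyXn map_polyC /= hornerM hornerC hornerXn.
rewrite mmapZ mmapX -mulrA; congr (_ * _).
rewrite /mmap1 big_ord_recr /= ext_fun_max; congr (_ * _).
by apply: eq_bigr => i _; rewrite ext_fun_widen mnmE.
Qed.

(** Substituting the last variable for the univariate one, and the remaining variables for
    themselves, recovers [p] from [muni p]. *)
Lemma muni_eq0 r (p : {mpoly k[r.+1]}) : muni p = 0 -> p = 0.
Proof.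
move=> p0; have := mmap_ext_fun (@mpolyC r.+1 k)
  (fun i : 'I_r => 'X_(widen_ord (leqnSn r) i)) ('X_ord_max) p.
rewrite p0 raddf0 horner0 => <-; rewrite {1}[p]mpolyE.
rewrite /mmap; apply: eq_bigr => m _; rewrite mul_mpolyC; congr (_ *: _).
rewrite mpolyXE_id; apply: eq_bigr => i _; congr (_ ^+ _).
rewrite /ext_fun; case: unliftP => [j ->|-> //].
by congr ('X__); apply: val_inj; rewrite /= /bump leqNgt ltn_ord.
Qed.

Variables (A : idomainType) (iota : {rmorphism k -> A}).

Definition alg_indep_mod (I : A -> Prop) r (g : 'I_r -> A) :=
  forall H : {mpoly k[r]}, I (mmap iota g H) -> H = 0.

Lemma prime_ideal_exp (P : A -> Prop) (x : A) n :
  is_prime_ideal P -> P (x ^+ n) -> P x.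
Proof.
move=> [_ P1 Pp]; elim: n => [|n IHn]; first by rewrite expr0.
by rewrite exprS => /Pp [|/IHn].
Qed.

(* Passing to a strictly smaller prime raises the transcendence degree: a
   relation modulo [P] can be cleared of its factors [h], and then read at
   [h = 0] modulo [Q]. *)
Lemma alg_indep_mod_ext (P Q : A -> Prop) r (g : 'I_r -> A) (h : A) :
  is_prime_ideal P -> is_prime_ideal Q -> sub_set P Q -> Q h -> ~ P h ->
  alg_indep_mod Q g -> alg_indep_mod P (ext_fun g h).
Proof.
move=> Pp [[Q0 Qadd Qmul] _ _] PQ Qh Ph gQ H PH.
apply: muni_eq0; apply: contrapT => /eqP H0.
have [n [q /implyP/(_ H0) q0 Hq]] := multiplicity_XsubC (muni H) 0.
rewrite polyC0 subr0 in Hq.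
have Pq : P (map_poly (mmap iota g) q).[h].
  move: PH; rewrite mmap_ext_fun Hq rmorphM /= map_polyXn hornerM hornerXn.
  by have [_ _ Pm] := Pp => /Pm [//|/(prime_ideal_exp Pp)].
have Qq : Q (mmap iota g q`_0).
  move: (PQ _ Pq); rewrite -horner_coef0.
  set s := map_poly _ _.
  have -> : mmap iota g q.[0] = s.[0] by rewrite !horner_coef0 coef_map.
  have : root (s - (s.[0])%:P) 0 by rewrite rootE hornerD hornerN hornerC subrr.
  case/factor_theorem => t; rewrite polyC0 subr0 => /eqP; rewrite subr_eq => /eqP st.
  move=> Qs; have -> : s.[0] = s.[h] + (- t.[h]) * h.
    by rewrite [in s.[h]]st hornerD hornerC hornerM hornerX; ring.
  exact: Qadd (Qmul _ _ Qh).
have := gQ _ Qq; rewrite -horner_coef0 => q00.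
by move: q0; rewrite rootE q00 eqxx.
Qed.

(** The induction is on the tail of the chain, so it starts at the largest prime, and each step down
    adds one independent element. *)
Lemma prime_chain_alg_indep n (P : nat -> A -> Prop) :
  prime_chain n P -> exists g : 'I_n -> A, alg_indep_mod (P 0%N) g.
Proof.
elim: n P => [|n IHn] P [Pp Ps].
  exists (fun _ => 0) => H.
  (* A polynomial in no variables is constant, and a nonzero constant is a unit, which a prime
     cannot contain. *)
  have -> : H = (H@_0)%:MP by apply: msize1_polyC; rewrite leqNgt; apply/negP => H1;
    have := H1; rewrite msizeE; apply/negP; rewrite -leqNgt; apply/bigmax_leqP_seq => m _ _;
    rewrite mdegE big_ord0.
  rewrite mmapC; have [->|c0] := eqVneq (H@_0) 0; first by rewrite mpolyC0.
  have [[_ _ Pm] P1 _] := Pp 0%N isT => /(Pm (iota (H@_0)^-1)).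
  by rewrite -rmorphM mulVf // rmorph1.
have [|g gP] := IHn (fun i => P i.+1).
  by split=> i lei; [apply: Pp | apply: Ps].
have [P01 P10] := Ps 0%N isT.
have [h Qh Ph] : exists2 h, P 1%N h & ~ P 0%N h.
  apply: contrapT => nh; apply: P10 => x Px; apply: contrapT => nPx; apply: nh.
  by exists x.
exists (ext_fun g h).
by apply: alg_indep_mod_ext gP => //; apply: Pp.
Qed.

End AlgebraicIndependence.

(** * Upper bound for the Krull dimension *)

Section AlgebraicDependence.
Variable k : fieldType.

Lemma msize_exp_le n (p : {mpoly k[n]}) e : (msize (p ^+ e) <= e * msize p + 1)%N.
Proof.
elim: e => [|e IHe]; first by rewrite expr0 msize1.
have [->|p0] := eqVneq p 0; first by rewrite expr0n /= msize0.
rewrite exprS msizeM ?expf_neq0 // mulSn -addnA.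
by apply: leq_trans (leq_pred _) _; rewrite leq_add2l.
Qed.

Lemma msize_mmap1_le n r (p : 'I_r -> {mpoly k[n]}) (m : 'X_{1..r}) S M :
  (forall i, msize (p i) <= S)%N -> (forall i, m i <= M)%N ->
  (msize (mmap1 p m) <= r * (M * S) + 1)%N.
Proof.
move=> pS mM; rewrite /mmap1.
have : (msize (\prod_(i < r) p i ^+ m i) <= \sum_(i < r) M * S + 1)%N; last first.
  by rewrite sum_nat_const card_ord.
elim/big_ind2: _ => [|a x b y xa yb|i _]; first by rewrite msize1.
- have [->|x0] := eqVneq x 0; first by rewrite mul0r msize0.
  have [->|y0] := eqVneq y 0; first by rewrite mulr0 msize0.
  by rewrite msizeM //; move: (mmeasure _ x) (mmeasure _ y) xa yb => sx sy; lia.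
- by apply: leq_trans (msize_exp_le _ _) _; rewrite leq_add2r leq_mul.
Qed.

(* Counting: the [M ^ d.+1] monomials of degrees [< M] in the [f i] live in a
   space whose dimension is only of order [M ^ d]. *)
Lemma mpoly_alg_dep d (f : 'I_d.+1 -> {mpoly k[d]}) :
  exists2 H : {mpoly k[d.+1]}, H != 0 & mmap (@mpolyC d k) f H = 0.
Proof.
pose S := \max_(i < d.+1) msize (f i).
(* Exponents are at most [K ^ d], so the values have size at most [d.+1 * (K ^ d * S) + 1 <= C],
   while [C ^ d = M ^ d * K ^ d < M ^ d.+1]. *)
pose K := (d.+1 * S + 1)%N; pose M := (K ^ d).+1; pose C := (M * K)%N.
pose I := {ffun 'I_d.+1 -> 'I_M}; pose J := {ffun 'I_d -> 'I_C}.
pose mI (u : I) : 'X_{1..d.+1} := [multinom (u i : nat) | i < d.+1].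
pose mJ (u : J) : 'X_{1..d} := [multinom (u i : nat) | i < d].
pose Mx : 'M[k]_(#|I|, #|J|) :=
  \matrix_(i, j) (mmap1 f (mI (enum_val i)))@_(mJ (enum_val j)).
have ltJI : (#|J| < #|I|)%N.
  rewrite !card_ffun !card_ord /C expnMn expnS mulnC ltn_pmul2r ?expn_gt0 //.
have [v v0 vM] : exists2 v : 'rV[k]_#|I|, v != 0 & v *m Mx = 0.
  have : kermx Mx != 0.
    rewrite kermx_eq0 /row_free; apply/negP => /eqP rk.
    by have := rank_leq_col Mx; rewrite rk leqNgt ltJI.
  case/rowV0Pn => v /sub_kermxP vM v0.
  by exists v.
have mI_inj : injective mI.
  move=> u u' /mnmP uu'; apply/ffunP => i; apply: val_inj.
  by have := uu' i; rewrite !mnmE.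
exists (\sum_i v 0 i *: 'X_[mI (enum_val i)]).
  apply: contra_neq v0 => H0; apply/rowP => i; rewrite mxE.
  have := congr1 (mcoeff (mI (enum_val i))) H0.
  rewrite raddf_sum /= (bigD1 i) //= mcoeffZ mcoeffX eqxx mulr1 big1 ?addr0 ?mcoeff0 //.
  move=> j ji; rewrite mcoeffZ mcoeffX (inj_eq mI_inj) (inj_eq enum_val_inj).
  by rewrite (negbTE ji) mulr0.
rewrite raddf_sum /=; under eq_bigr do rewrite mmapZ mmapX mul_mpolyC.
apply/mpolyP => m; rewrite mcoeff0 raddf_sum /=.
have [/forallP mC|] := boolP [forall i, m i < C]%N.
  pose u : J := [ffun i => Ordinal (mC i)].
  have -> : m = mJ (enum_val (enum_rank u)).
    by rewrite enum_rankK; apply/mnmP => i; rewrite mnmE ffunE.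
  have := congr1 (fun M : 'rV__ => M 0 (enum_rank u)) vM; rewrite !mxE => vM0.
  rewrite -[RHS]vM0.
  by apply: eq_bigr => i _; rewrite mcoeffZ mxE.
rewrite negb_forall => /existsP[i Ci]; rewrite -leqNgt in Ci.
rewrite big1 // => j _; rewrite mcoeffZ; apply/eqP; rewrite mulf_eq0; apply/orP; right.
rewrite mcoeff_eq0; apply: msize_mdeg_ge.
apply: leq_trans (msize_mmap1_le (S := S) (M := (K ^ d)%N) _ _) _.
- by move=> l; apply: leq_bigmax.
- by move=> l; rewrite mnmE -ltnS.
apply: (@leq_trans C); last by apply: leq_trans Ci _; rewrite mdegE (bigD1 i) //= leq_addr.
rewrite /C /M /K; set X := (_ ^ d)%N; nia.
Qed.

(** A chain of length [d.+1] would give [d.+1] elements independent modulo its smallest prime, but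
    they are polynomials in [d] generators and so satisfy a relation. *)
Lemma krull_dim_ub (A : idomainType) (iota : {rmorphism k -> A}) d (g : 'I_d -> A) :
  (forall a, exists p : {mpoly k[d]}, a = mmap iota g p) ->
  ~ exists P, prime_chain (A := A) d.+1 P.
Proof.
move=> gA [P cP]; have [f fP] := prime_chain_alg_indep iota cP.
have [F FE] : exists F : 'I_d.+1 -> {mpoly k[d]}, forall i, f i = mmap iota g (F i).
  by have [F FE] := choice (fun i => gA (f i)); exists F.
have [H H0 HF] := mpoly_alg_dep F.
move/eqP: H0; apply; apply: fP.
have -> : mmap iota f H = mmap iota g (mmap (@mpolyC d k) F H).
  rewrite [X in _ = mmap _ _ X](_ : _ =
    \sum_(m <- msupp H) (H@_m)%:MP * mmap1 F m) // rmorph_sum /=; apply: eq_bigr => m _.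
  rewrite rmorphM /= mmapC; congr (_ * _); rewrite /mmap1 rmorph_prod.
  by apply: eq_bigr => i _; rewrite rmorphXn /= FE.
by rewrite HF raddf0; have [[]] := cP.1 0%N isT.
Qed.

End AlgebraicDependence.

(** * Generators and prime chains of a polynomial ring *)

Section PolynomialExtension.
Variables (k : fieldType) (A : idomainType) (iota : {rmorphism k -> A}).

Lemma mmap_mwiden (S : comNzRingType) (f : {rmorphism k -> S}) r (g : 'I_r -> S) h p :
  mmap f (ext_fun g h) (mwiden p) = mmap f g p.
Proof.
rewrite [p in LHS]mpolyE (raddf_sum (@mwiden r k)) raddf_sum /=; apply: eq_bigr => m _.
rewrite mwidenZ mwidenX mmapZ mmapX; congr (_ * _).
rewrite /mmap1 big_ord_recr /= mnmwiden_ordmax expr0 mulr1.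
by apply: eq_bigr => i _; rewrite ext_fun_widen mnmwiden_widen.
Qed.

Lemma poly_generated n (g : 'I_n -> A) :
  (forall a, exists p : {mpoly k[n]}, a = mmap iota g p) ->
  forall a : {poly A}, exists p : {mpoly k[n.+1]},
    a = mmap (polyC \o iota) (ext_fun (polyC \o g) 'X) p.
Proof.
move=> gA; elim/poly_ind => [|q c [p ->]]; first by exists 0; rewrite mmap0.
have [r ->] := gA c.
exists (p * 'X_ord_max + mwiden r).
rewrite mmapD rmorphM /= mmapX mmap1U ext_fun_max mmap_mwiden; congr (_ + _).
rewrite /mmap rmorph_sum; apply: eq_bigr => m _ /=.
rewrite rmorphM /=; congr (_ * _); rewrite /mmap1 rmorph_prod.
by apply: eq_bigr => i _; rewrite rmorphXn.
Qed.

(** The new chain consists of the zero ideal followed by the preimages of the old primes under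
    evaluation at 0; the first inclusion is strict because of ['X]. *)
Lemma poly_prime_chain n :
  (exists P, prime_chain (A := A) n P) -> exists P, prime_chain (A := {poly A}) n.+1 P.
Proof.
move=> [P [Pp Ps]].
exists (fun i (p : {poly A}) => if i is i'.+1 then P i' p`_0 else p = 0).
split=> [[_|i /Pp]|[_|i /Ps]].
- split; last 1 first.
  + by move=> x y /eqP; rewrite mulf_eq0 => /orP[]/eqP; [left|right].
  + by split=> // [x y -> ->|a x ->]; rewrite ?addr0 ?mulr0.
  + by apply/eqP; exact: oner_neq0.
- case=> [[P0 Pa Pm] P1 Pmul]; split; last 1 first.
  + by move=> x y; rewrite coef0M => /Pmul.
  + by split=> [|x y|a x]; rewrite ?coef0 ?coefD ?coef0M //; [exact: Pa | exact: Pm].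
  + by rewrite coef1.
- have [[P0 _ _] _ _] := Pp 0%N isT.
  split=> [p ->|]; first by rewrite coef0.
  move=> /(_ 'X); rewrite coefX => /(_ P0) X0.
  by have := polyX_eq0 A; rewrite X0 eqxx.
- by case=> PP nPP; split=> [p /PP //|PP']; apply: nPP => x;
     have := PP' x%:P; rewrite coefC.
Qed.

End PolynomialExtension.

(** * Derivations *)

Section Derivations.

Definition derivation (A : nzRingType) (D : A -> A) :=
  (forall x y, D (x + y) = D x + D y) /\ (forall x y, D (x * y) = D x * y + x * D y).

Section Theory.
Variables (A : nzRingType) (D : A -> A).
Hypothesis derD : derivation D.

Lemma der0 : D 0 = 0.
Proof. by apply: (addrI (D 0)); rewrite -derD.1 !addr0. Qed.

Lemma derN x : D (- x) = - D x.
Proof. by apply: (addIr (D x)); rewrite -derD.1 !addNr der0. Qed.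

Lemma derB x y : D (x - y) = D x - D y.
Proof. by rewrite derD.1 derN. Qed.

Lemma der1 : D 1 = 0.
Proof.
by apply: (addrI (D 1)); rewrite addr0 -{3}(mulr1 1) derD.2 mulr1 mul1r.
Qed.

Lemma der_nat n : D n%:R = 0.
Proof. by elim: n => [|n IHn]; rewrite ?der0 // -natr1 derD.1 IHn der1 addr0. Qed.

Lemma der_sum (I : Type) (r : seq I) (F : I -> A) :
  D (\sum_(i <- r) F i) = \sum_(i <- r) D (F i).
Proof. exact: (big_morph D derD.1 der0). Qed.

End Theory.

Lemma der_exp (A : comNzRingType) (D : A -> A) (x : A) n :
  derivation D -> D (x ^+ n) = n%:R * x ^+ n.-1 * D x.
Proof.
move=> dD; elim: n => [|n IHn]; first by rewrite expr0 der1 // !mul0r.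
rewrite exprS dD.2 IHn -[in RHS]natr1; case: n IHn => [|n] _ /=; first by rewrite !expr0; ring.
by rewrite exprS; ring.
Qed.

Lemma der_exp_eigen (A : comNzRingType) (D : A -> A) (x a : A) n :
  derivation D -> D x = x * a -> D (x ^+ n) = x ^+ n * (n%:R * a).
Proof.
move=> dD Dx; rewrite der_exp // Dx; case: n => [|n] /=; first by ring.
by rewrite exprS; ring.
Qed.

Lemma der_comb (A : comNzRingType) (D1 D2 : A -> A) (a b : A) :
  derivation D1 -> derivation D2 -> derivation (fun x => a * D1 x + b * D2 x).
Proof.
move=> d1 d2; split=> x y; first by rewrite d1.1 d2.1; ring.
by rewrite d1.2 d2.2; ring.
Qed.

(** The extension of [D] for which the variable is an eigenvector of eigenvalue [mu]. With [mu = 0]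
    it acts coefficientwise; with [D = 0] and [mu = 1] it is the Euler derivation. *)
Definition der_poly (A : comNzRingType) (D : A -> A) (mu : A) (p : {poly A}) : {poly A} :=
  \poly_(i < size p) (D p`_i + i%:R * mu * p`_i).

Section DerPoly.
Variables (A : comNzRingType) (D : A -> A) (mu : A).
Hypothesis derD : derivation D.

Lemma coef_der_poly p i : (der_poly D mu p)`_i = D p`_i + i%:R * mu * p`_i.
Proof.
rewrite coef_poly; case: ltnP => // le_pi.
by rewrite nth_default // (der0 derD) mulr0 addr0.
Qed.

Lemma der_polyP : derivation (der_poly D mu).
Proof.
split=> p q; apply/polyP => i.
  by rewrite !(coefD, coef_der_poly) derD.1; ring.
rewrite coef_der_poly coefD !coefM (der_sum derD) mulr_sumr -!big_split /=.
apply: eq_bigr => j _; rewrite !coef_der_poly derD.2.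
have -> : (i%:R : A) = j%:R + (i - j)%:R by rewrite -natrD subnKC // -ltnS.
by ring.
Qed.

Lemma der_polyC a : der_poly D mu a%:P = (D a)%:P.
Proof.
apply/polyP => i; rewrite coef_der_poly !coefC.
by case: i => [|i] /=; rewrite ?(der0 derD); ring.
Qed.

Lemma der_polyX : der_poly D mu 'X = mu *: 'X.
Proof.
apply/polyP => i; rewrite coef_der_poly coefZ coefX.
by rewrite (der_nat derD); case: eqP => [->|_] /=; ring.
Qed.

End DerPoly.

Lemma deriv_derivation (A : comNzRingType) : derivation (@deriv A).
Proof. by split=> p q; rewrite ?derivD // derivM. Qed.

Lemma derivation0 (A : nzRingType) : derivation (fun _ : A => 0).
Proof. by split=> x y; rewrite ?addr0 // mul0r mulr0 addr0. Qed.

Lemma der_hom_poly (A L : comNzRingType) (h : {rmorphism {poly A} -> L})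
    (D : {poly A} -> {poly A}) (D' : L -> L) :
  derivation D -> derivation D' ->
  (forall a, h (D a%:P) = D' (h a%:P)) -> h (D 'X) = D' (h 'X) ->
  forall p, h (D p) = D' (h p).
Proof.
move=> dD dD' hC hX; elim/poly_ind => [|p c IHp].
  by rewrite rmorph0 (der0 dD) (der0 dD') rmorph0.
rewrite dD.1 dD.2 !rmorphD /= !rmorphM /= hC hX IHp.
by rewrite dD'.1 dD'.2.
Qed.

End Derivations.

Section PolynomialEvaluation.

Definition pev (A : nzRingType) (L : comNzRingType) (f : {rmorphism A -> L}) (u : L) :
  {rmorphism {poly A} -> L} := horner_morph (fun x => mulrC u (f x)).

Lemma pevC (A : nzRingType) (L : comNzRingType) (f : {rmorphism A -> L}) u a :
  pev f u a%:P = f a.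
Proof. exact: horner_morphC. Qed.

Lemma pevX (A : nzRingType) (L : comNzRingType) (f : {rmorphism A -> L}) u :
  pev f u 'X = u.
Proof. exact: horner_morphX. Qed.

Lemma rmorph_poly_ext (A L : nzRingType) (f g : {rmorphism {poly A} -> L}) :
  (forall a, f a%:P = g a%:P) -> f 'X = g 'X -> f =1 g.
Proof.
move=> fC fX; elim/poly_ind => [|p c IHp]; first by rewrite !rmorph0.
by rewrite !rmorphD !rmorphM /= IHp fX fC.
Qed.

End PolynomialEvaluation.

(** * The vector field *)

Section VectorField.

(* With [t = x y z], the vector field [x field_x, y field_y, field_w] is twice
   the horizontal lift of [t (1 - 27 t) d/dt] to the universal vector extension
   of the family of elliptic curves [x y z = t (x + y + z)^3], in the chart
   [x + y + z = 1]. *)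
Definition field_x (R : comNzRingType) (x y w : R) : R :=
  let z := 1 - x - y in
  w * (z - y) + 1 + 4%:R * y * z - 3%:R * x - 18%:R * x * y * z + 2%:R * x * x.

Definition field_y (R : comNzRingType) (x y w : R) : R :=
  let z := 1 - x - y in
  w * (x - z) + 1 + 4%:R * z * x - 3%:R * y - 18%:R * x * y * z + 2%:R * y * y.

Definition field_w (R : comNzRingType) (x y w : R) : R :=
  let z := 1 - x - y in
  2%:R * w * (x * y + y * z + z * x - 9%:R * x * y * z)
  - 2%:R * (x - y) * (y - z) * (z - x).

Lemma rmorph_field (R L : comNzRingType) (h : {rmorphism R -> L}) x y w :
  [/\ h (field_x x y w) = field_x (h x) (h y) (h w),
      h (field_y x y w) = field_y (h x) (h y) (h w)
    & h (field_w x y w) = field_w (h x) (h y) (h w)].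
Proof. by split; rewrite /field_x /field_y /field_w; ring. Qed.

(** Exchanging [x] and [y] while negating [w] is a symmetry of the vector field; it exchanges the
    two edges at a corner. *)
Lemma field_swap (R : comNzRingType) (x y w : R) :
  [/\ field_x y x (- w) = field_y x y w, field_y y x (- w) = field_x x y w
    & field_w y x (- w) = - field_w x y w].
Proof. by split; rewrite /field_x /field_y /field_w; ring. Qed.

(** The cyclic symmetry of the triangle. The first identity gives the derivative of [z] as a
    multiple of [z], so the third edge is invariant too. *)
Lemma field_rot (R : comNzRingType) (x y w : R) (z := 1 - x - y) :
  [/\ z * field_x z x w = - (x * field_x x y w) - y * field_y x y w,
      field_y z x w = field_x x y w & field_w z x w = field_w x y w].
Proof. by split; rewrite /field_x /field_y /field_w /z; ring. Qed.

Variable k : fieldType.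
Local Notation S := {poly k}.
Local Notation R := {poly {poly k}}.
Local Notation B := {poly {poly {poly k}}}.

Definition Bconst : {rmorphism k -> B} := polyC \o (polyC \o polyC).
(** The variable [y] is outermost and [w] innermost: evaluating once at 0 restricts to the edge
    [y = 0], evaluating twice restricts to the corner and leaves a polynomial in [w]. *)
Definition Bw : B := 'X%:P%:P.
Definition Bx : B := 'X%:P.
Definition By : B := 'X.

Definition bev (L : comNzRingType) (j : {rmorphism k -> L}) (x y w : L) :
  {rmorphism B -> L} := pev (pev (pev j w) x) y.

Lemma bevE (L : comNzRingType) (j : {rmorphism k -> L}) (x y w : L) :
  [/\ bev j x y w Bx = x, bev j x y w By = y, bev j x y w Bw = w
    & forall c, bev j x y w (Bconst c) = j c].
Proof. by split=> [|||c]; rewrite /bev /= ?(pevX, pevC) ?(pevX, pevC) ?(pevX, pevC). Qed.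

Lemma B_ind (P : B -> Prop) :
  (forall p q, P p -> P q -> P (p + q)) -> (forall p q, P p -> P q -> P (p * q)) ->
  P Bx -> P By -> P Bw -> (forall c, P (Bconst c)) -> forall p, P p.
Proof.
move=> PD PM Px Py Pw Pc.
have P0 : P 0 by have := Pc 0; rewrite rmorph0.
elim/poly_ind => // p a Pp; apply: (PD); first exact: (PM).
elim/poly_ind: a => [|a b Pa]; first by rewrite polyC0.
rewrite polyCD polyCM; apply: (PD); first exact: (PM).
elim/poly_ind: b => [|b c Pb]; first by rewrite !polyC0.
rewrite !polyCD !polyCM; apply: (PD); first exact: (PM).
exact: (Pc).
Qed.

Lemma bev_ext (L : nzRingType) (f g : {rmorphism B -> L}) :
  f Bx = g Bx -> f By = g By -> f Bw = g Bw ->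
  (forall c, f (Bconst c) = g (Bconst c)) -> f =1 g.
Proof.
move=> ex ey ew ec; apply: B_ind => // p q ep eq.
  by rewrite (rmorphD f) (rmorphD g) ep eq.
by rewrite (rmorphM f) (rmorphM g) ep eq.
Qed.

Lemma der_hom_B (L : comNzRingType) (h : {rmorphism B -> L}) (D : B -> B) (D' : L -> L) :
  derivation D -> derivation D' ->
  h (D Bx) = D' (h Bx) -> h (D By) = D' (h By) -> h (D Bw) = D' (h Bw) ->
  (forall c, h (D (Bconst c)) = D' (h (Bconst c))) -> forall p, h (D p) = D' (h p).
Proof.
move=> dD dD' hx hy hw hc; apply: B_ind => // p q ep eq.
  by rewrite dD.1 (rmorphD h) ep eq (rmorphD h) dD'.1.
by rewrite dD.2 (rmorphD h) !(rmorphM h) ep eq dD'.2.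
Qed.

(** The three derivatives are those in [y], [x] and [w], the last two applied coefficientwise. The
    factor [1] gives the shape expected by [der_comb]. *)
Definition delta (p : B) : B :=
  By * field_y Bx By Bw * p^`() +
  1 * (Bx * field_x Bx By Bw * der_poly (@deriv _) 0 p +
       field_w Bx By Bw * der_poly (der_poly (@deriv _) 0) 0 p).

Lemma delta_der : derivation delta.
Proof.
apply: der_comb; first exact: deriv_derivation.
by apply: der_comb; apply: der_polyP; last apply: der_polyP; apply: deriv_derivation.
Qed.

Lemma deltaE :
  [/\ delta Bx = Bx * field_x Bx By Bw, delta By = By * field_y Bx By Bw,
      delta Bw = field_w Bx By Bw & forall c, delta (Bconst c) = 0].
Proof.
have dd := @deriv_derivation; have dp := fun A D => @der_polyP A D 0.
split=> [|||c]; rewrite /delta.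
- rewrite /Bx /By derivC !der_polyC ?derivX ?derivC; try by [apply: dd | apply: dp; apply: dd].
  by rewrite (der_polyX 0 (dd _)) scale0r polyC0 polyC1; ring.
- rewrite derivX !der_polyX ?scale0r; try by [apply: dd | apply: dp; apply: dd].
  by ring.
- rewrite /Bw derivC !der_polyC ?derivX ?derivC; try by [apply: dd | apply: dp; apply: dd].
  by rewrite !polyC0 !polyC1; ring.
- rewrite /= derivC !der_polyC ?derivC ?polyC0; try by [apply: dd | apply: dp; apply: dd].
  by ring.
Qed.

(** Any solution of the differential system yields a differential morphism. This serves both for the
    symmetries of [B] and for the formal leaves. *)
Lemma bev_der (L : comNzRingType) (j : {rmorphism k -> L}) (D : L -> L) (x y w : L) :
  derivation D -> (forall c, D (j c) = 0) ->
  D x = x * field_x x y w -> D y = y * field_y x y w -> D w = field_w x y w ->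
  forall p, bev j x y w (delta p) = D (bev j x y w p).
Proof.
move=> dD Dj Dx Dy Dw; have [ex ey ew ec] := bevE j x y w.
have [dx dy dw dc] := deltaE; have [hx hy hw] := rmorph_field (bev j x y w) Bx By Bw.
have dd := delta_der.
apply: der_hom_B => // [|||c].
- by rewrite dx (rmorphM (bev j x y w)) hx ex ey ew Dx.
- by rewrite dy (rmorphM (bev j x y w)) hy ex ey ew Dy.
- by rewrite dw hw ex ey ew Dw.
- by rewrite dc ec Dj rmorph0.
Qed.

Definition swapB : {rmorphism B -> B} := bev Bconst By Bx (- Bw).

Lemma swapB_delta p : swapB (delta p) = delta (swapB p).
Proof.
have [dx dy dw dc] := deltaE; have [sx sy sw] := field_swap Bx By Bw.
apply: bev_der => //; first exact: delta_der.
- by rewrite dy sx.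
- by rewrite dx sy.
- by rewrite (derN delta_der) dw sw.
Qed.

Lemma swapBK : involutive swapB.
Proof.
have [ex ey ew ec] := bevE Bconst By Bx (- Bw).
apply: (@bev_ext _ (swapB \o swapB) idfun) => [|||c] /=; rewrite /swapB ?(ex, ey) ?ec //.
by rewrite ew rmorphN /= ew opprK.
Qed.

Definition rotB : {rmorphism B -> B} := bev Bconst (1 - Bx - By) Bx Bw.

Lemma rotB_delta p : rotB (delta p) = delta (rotB p).
Proof.
have [dx dy dw dc] := deltaE; have [sx sy sw] := field_rot Bx By Bw.
have dd := delta_der.
apply: bev_der => //; rewrite ?sx ?sy ?sw //.
by rewrite !(derB dd) (der1 dd) dx dy sub0r.
Qed.

Lemma rotBK p : rotB (rotB (rotB p)) = p.
Proof.
have [ex ey ew ec] := bevE Bconst (1 - Bx - By) Bx Bw; rewrite -/rotB in ex ey ew ec.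
apply: (@bev_ext _ (rotB \o (rotB \o rotB)) idfun) => [|||c] /=.
- by rewrite !ex !rmorphB rmorph1 /= ex ey rmorphB rmorphB rmorph1 /= ex ey; ring.
- by rewrite ey ex !rmorphB rmorph1 /= ex ey; ring.
- by rewrite !ew.
- by rewrite !ec.
Qed.

End VectorField.

Lemma natr_inj (k : fieldType) : [pchar k] =i pred0 -> injective (fun n => n%:R : k).
Proof.
move=> /pcharf0P char0 m n /eqP; rewrite -subr_eq0.
wlog le_nm : m n / (n <= m)%N => [H|].
  by case/orP: (leq_total n m) => [/H //|/H{}H mn]; apply/esym/H; rewrite -opprB oppr_eq0.
by rewrite -natrB // char0 subn_eq0 => le_mn; apply/eqP; rewrite eqn_leq le_mn.
Qed.

(** * First integrals *)

Section Corner.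
Variable k : fieldType.
Hypothesis char0 : [pchar k] =i pred0.
Local Notation S := {poly k}.
Local Notation R := {poly {poly k}}.
Local Notation B := {poly {poly {poly k}}}.

Definition corner : {rmorphism B -> S} := horner_eval (0 : S) \o horner_eval (0 : R).

(** The restriction of [delta] to the invariant plane [y = 0]: there the field is
    [x (1 - x) (w + 1 - 2 x)] times the constant direction [d/dx + 2 d/dw]. *)
Definition edge_der (r : R) : R :=
  'X * (1 - 'X) * ('X%:P + 1 - 2%:R * 'X) * (r^`() + 2%:R * der_poly (@deriv _) 0 r).

Lemma delta_edge (G : B) : (delta G).[0] = edge_der G.[0].
Proof.
rewrite /delta; have [ex _ ew] := rmorph_field (horner_eval (0 : R)) (@Bx k) (@By k) (@Bw k).
move: (field_x _ _ _) (field_w _ _ _) (field_y _ _ _) ex ew => a b c ex ew.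
rewrite !(hornerD, hornerM) {1}/By hornerX !mul0r add0r hornerC mul1r.
rewrite -[a.[0]]/(horner_eval 0 a) -[b.[0]]/(horner_eval 0 b) ex ew.
rewrite !horner_coef0 !coef_der_poly; try exact: deriv_derivation;
  try by apply: der_polyP; apply: deriv_derivation.
rewrite !mul0r !addr0 -!horner_coef0.
rewrite /= /horner_eval /Bx /By /Bw hornerX !hornerC /field_x /field_w /edge_der.
by set x := 'X : R; set w := 'X%:P : R; ring.
Qed.

Lemma edge_der_der : derivation edge_der.
Proof.
pose a : R := 'X * (1 - 'X) * ('X%:P + 1 - 2%:R * 'X).
have d1 := @deriv_derivation S; have d2 := der_polyP 0 (@deriv_derivation k).
have d := der_comb a (a * 2%:R) d1 d2.
have e r : edge_der r = a * r^`() + a * 2%:R * der_poly (@deriv _) 0 r.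
  by rewrite /edge_der -/a mulrDr mulrA.
by split=> x y; rewrite !e ?(d.1 x y) ?(d.2 x y).
Qed.

Lemma edge_derX : edge_der 'X = 'X * ((1 - 'X) * ('X%:P + 1 - 2%:R * 'X)).
Proof.
by rewrite /edge_der derivX (der_polyX _ (@deriv_derivation _)) scale0r mulr0 addr0; ring.
Qed.

Lemma edge_der_corner r : (edge_der r).[0] = 0.
Proof. by rewrite /edge_der !hornerM hornerX !mul0r. Qed.

Lemma X_order (A : idomainType) (p : {poly A}) :
  p != 0 -> exists n q, p = 'X^n * q /\ q.[0] != 0.
Proof.
move=> p0; have [n [q /implyP/(_ p0) q0 pE]] := multiplicity_XsubC p 0.
by exists n, q; rewrite mulrC {1}pE polyC0 subr0.
Qed.

(** The lexicographically lowest term: [j] is the order along [y = 0], [i] the order in [x] of what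
    then remains on that edge, and [g.[0]] the coefficient, a polynomial in [w]. *)
Lemma corner_order (G : B) : G != 0 ->
  exists j G1 i g, [/\ G = 'X^j * G1, G1.[0] = 'X^i * g & g.[0] != 0].
Proof.
case/X_order => j [G1 [GE /X_order[i [g [gE g0]]]]].
by exists j, G1, i, g.
Qed.

(* At the corner the two axes are invariant with the eigenvalues [1 + w] and
   [1 - w], so the cofactor of a Darboux polynomial determines its orders. *)
Lemma corner_cofactor (r G M G1 : B) j i (g : R) :
  r * delta G = G * M -> G = 'X^j * G1 -> G1.[0] = 'X^i * g -> g.[0] != 0 ->
  corner r * (j%:R * (1 - 'X) + i%:R * (1 + 'X)) = corner M.
Proof.
move=> rG GE G1E g0; have dd := @delta_der k; have [_ dy _ _] := deltaE k.
(* Cancelling [y ^ j] contributes [j] times the cofactor of [y]. After restriction to [y = 0] the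
   same is done with [x ^ i]. *)
have {}rG : r * (j%:R * field_y (@Bx k) (@By k) (@Bw k) * G1 + delta G1) = G1 * M.
  apply: (@mulfI _ 'X^j); first by rewrite expf_neq0 // polyX_eq0.
  rewrite [RHS]mulrA -GE -rG GE dd.2 -/(By k) (der_exp_eigen _ dd dy); ring.
have [_ fy' _] := rmorph_field (horner_eval (0 : R)) (@Bx k) (@By k) (@Bw k).
have fy : (field_y (@Bx k) (@By k) (@Bw k)).[0] =
  field_y (@Bx k).[0] (@By k).[0] (@Bw k).[0] := fy'.
have dG1 := delta_edge G1; have de := edge_der_der.
rewrite G1E de.2 (der_exp_eigen _ de edge_derX) in dG1.
have hx : (@Bx k).[0] = 'X by apply: hornerC.
have hy : (@By k).[0] = 0 by apply: hornerX.
have hw : (@Bw k).[0] = 'X%:P by apply: hornerC.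
rewrite hx hy hw in fy.
move: (delta G1) (field_y _ _ _) rG fy dG1 => D1 f rG fy D1E.
move/(congr1 (horner_eval (0 : R))): rG.
rewrite rmorphM rmorphD rmorphM rmorphM rmorph_nat rmorphM /= /horner_eval G1E D1E fy => rg.
have {}rg : r.[0] * (j%:R * field_y 'X 0 'X%:P * g +
    (i%:R * ((1 - 'X) * ('X%:P + 1 - 2%:R * 'X)) * g + edge_der g)) = g * M.[0].
  apply: (@mulfI _ 'X^i); first by rewrite expf_neq0 // polyX_eq0.
  by rewrite [RHS]mulrA -rg; ring.
have [_ e' _] := rmorph_field (horner_eval (0 : S)) ('X : R) 0 'X%:P.
have e : (field_y ('X : R) 0 'X%:P).[0] = field_y ('X : R).[0] (0 : R).[0] ('X%:P : R).[0] := e'.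
have dg := edge_der_corner g; rewrite hornerX !hornerC in e.
move: (field_y _ _ _) (edge_der g) rg e dg => c dg rg e dg0.
move/(congr1 (horner_eval (0 : S))): rg.
rewrite !(rmorphM, rmorphD, rmorphN, rmorph1, rmorph_nat) /= /horner_eval dg0 e addr0.
rewrite !hornerX !hornerC => e0.
apply: (mulfI g0); rewrite -e0 /field_y; ring.
Qed.

Lemma corner_swap p : corner (swapB k p) = corner p \Po (- 'X).
Proof.
have [ex ey ew ec] := bevE (@Bconst k) (@By k) (@Bx k) (- (@Bw k)).
have H : corner \o swapB k =1 (comp_poly (- 'X)) \o corner.
  apply: bev_ext => [|||c]; rewrite /= /swapB ?ex ?ey ?ew ?ec /horner_eval /Bx /By /Bw /=.
  - by rewrite !(hornerX, hornerC) comp_polyC.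
  - by rewrite !(hornerX, hornerC) comp_polyC.
  - by rewrite !(hornerN, hornerC) comp_polyX.
  - by rewrite !hornerC comp_polyC.
exact: H.
Qed.

(* Comparing the orders read in the two coordinates forces a Darboux polynomial
   at the corner to be a monomial times a unit. *)
Lemma corner_monomial (r G M : B) :
  r * delta G = G * M -> corner r != 0 -> G != 0 ->
  exists i j G1, [/\ corner M = corner r * (j%:R * (1 - 'X) + i%:R * (1 + 'X)),
    G = 'X^j * G1, G1.[0] != 0, i = 0 -> corner G1 != 0
    & exists2 H : B, swapB k G = 'X^i * H & H.[0] != 0].
Proof.
move=> rG r0 G0.
have [j [G1 [i [g [GE G1E g0]]]]] := corner_order G0.
have cM := corner_cofactor rG GE G1E g0.
have sG0 : swapB k G != 0.
  by apply: contra_neq G0 => s0; rewrite -[G]swapBK s0 rmorph0.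
(* For the swapped polynomial, [i'] is the order of [G] along [x = 0]. *)
have [i' [H [j' [h [HE H0 h0]]]]] := corner_order sG0.
have sr : swapB k r * delta (swapB k G) = swapB k G * swapB k M.
  by rewrite -swapB_delta -!rmorphM rG.
have := corner_cofactor sr HE H0 h0; rewrite !corner_swap.
have sK p : (p \Po (- 'X)) \Po (- 'X) = p :> S.
  by rewrite -comp_polyA rmorphN /= comp_polyX opprK comp_polyXr.
move=> cM'.
have eij0 : corner r * (j%:R * (1 - 'X) + i%:R * (1 + 'X)) =
    corner r * (i'%:R * (1 + 'X) + j'%:R * (1 - 'X)).
  rewrite cM -[corner M]sK -cM' comp_polyM sK; congr (_ * _).
  rewrite comp_polyD !comp_polyM !comp_polyB !comp_polyD comp_polyX !rmorph_nat !rmorph1.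
  by rewrite opprK.
move: eij0.
move/(mulfI r0) => eij.
(* The coefficients of 1 and [w] give [i + j = i' + j'] and [i - j = i' - j'], hence [i = i'] and
   [j = j']. *)
have [c0 c1] : (i' + j' = j + i /\ i' + j = i + j')%N.
  have e0 := congr1 (coefp 0) eij; have e1 := congr1 (coefp 1) eij.
  move: e0 e1; rewrite /coefp -!polyC_natr.
  rewrite !(coefD, coefCM, coefN, coef1, coefX) /= => e0 e1.
  split; apply: (natr_inj char0); rewrite !natrD.
    transitivity (i'%:R * (1 + 0) + j'%:R * (1 - 0) : k); first by ring.
    by rewrite -e0; ring.
  transitivity (i'%:R * (0 + 1) + j'%:R * (0 - 1) + j'%:R + j%:R : k); first by ring.
  by rewrite -e1; ring.
exists i, j, G1; split=> //.
- by rewrite G1E mulf_neq0 ?expf_neq0 ?polyX_eq0 //; apply: contra_neq g0 => ->; rewrite horner0.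
- by move=> i0; rewrite -[corner G1]/(G1.[0].[0]) G1E i0 expr0 mul1r.
exists H => //; first by rewrite HE; congr ('X^_ * _); lia.
by rewrite H0 mulf_neq0 ?expf_neq0 ?polyX_eq0 //; apply: contra_neq h0 => ->; rewrite horner0.
Qed.

End Corner.

(** * Restriction of a first integral to a corner *)

Section CornerRepresentation.

(** Division by the gcd and the Bezout identity over the fraction field of [A], with denominators
    cleared; the combination is therefore a nonzero constant [r] instead of 1. *)
Lemma coprime_rep (A : idomainType) (P Q : {poly A}) : P != 0 -> Q != 0 ->
  exists P1 Q1 u v r, [/\ P * Q1 = Q * P1, u * P1 + v * Q1 = r%:P & r != 0].
Proof.
move=> P0 Q0; have g0 : gcdp P Q != 0 by rewrite gcdp_eq0 (negbTE P0).
have [/Pdiv.Idomain.dvdpP[[c q1] /= c0 cP]] := (dvdp_gcdl P Q).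
have [/Pdiv.Idomain.dvdpP[[d q2] /= d0 dQ]] := (dvdp_gcdr P Q).
have [[u v] /= /eqpP[[a b] /= /andP[a0 b0] uv]] := Bezoutp P Q.
exists (d%:P * q1), (c%:P * q2), (a%:P * u), (a%:P * v), (b * c * d).
rewrite -!mul_polyC in cP dQ uv.
split; last by rewrite !mulf_neq0.
- apply: (mulIf g0).
  rewrite -[RHS]mulrA -[d%:P * q1 * _]mulrA -cP -[LHS]mulrA -[c%:P * q2 * _]mulrA -dQ; ring.
- apply: (mulIf g0); rewrite !polyCM.
  transitivity (a%:P * (u * (q1 * gcdp P Q) * d%:P + v * (q2 * gcdp P Q) * c%:P)); first by ring.
  rewrite -cP -dQ; transitivity (a%:P * (u * P + v * Q) * c%:P * d%:P); first by ring.
  by rewrite uv; ring.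
Qed.

Lemma Xn_dvd (A : idomainType) e (a p m : {poly A}) :
  'X^e * a = p * m -> p.[0] != 0 -> exists m', m = 'X^e * m'.
Proof.
move=> am p0; have [->|m0] := eqVneq m 0; first by exists 0; rewrite mulr0.
have [n [q [mE q0]]] := X_order m0; have [le_en|lt_ne] := leqP e n.
  by exists ('X^(n - e) * q); rewrite mulrA -exprD subnKC.
have : 'X^(e - n) * a = p * q.
  apply: (@mulfI _ 'X^n); first by rewrite expf_neq0 // polyX_eq0.
  by rewrite mulrA -exprD subnKC 1?ltnW // am mE; ring.
move/(congr1 (horner^~ 0)); rewrite !hornerM hornerXn -subnSK // expr0n /= mul0r => /esym/eqP.
by rewrite mulf_eq0 (negbTE p0) (negbTE q0).
Qed.

(** The relation says that the fraction [P/Q] has logarithmic derivative [m], which depends only on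
    the fraction and not on the pair representing it. *)
Lemma relation_transfer (A : idomainType) (D : A -> A) (P Q P1 Q1 m : A) :
  derivation D -> P != 0 -> Q != 0 -> P * Q1 = Q * P1 ->
  D P * Q - P * D Q = m * (P * Q) -> D P1 * Q1 - P1 * D Q1 = m * (P1 * Q1).
Proof.
move=> dD P0 Q0 e1 e3; have e2 := congr1 D e1; rewrite !dD.2 in e2.
apply/eqP; rewrite -subr_eq0; apply/eqP.
apply: (@mulfI _ (Q * Q * P)); first by rewrite !mulf_neq0.
move/eqP: e1; rewrite -subr_eq0 => /eqP e1; move/eqP: e3; rewrite -subr_eq0 => /eqP e3.
move/eqP: e2; rewrite -subr_eq0 => /eqP e2.
transitivity (P * Q1 * Q1 * (D P * Q - P * D Q - m * (P * Q)) +
  (P * Q1 * D Q + Q * P * D Q1 + m * P * Q * Q1) * (P * Q1 - Q * P1) -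
  Q * P * Q1 * (D P * Q1 + P * D Q1 - (D Q * P1 + Q * D P1))); first by ring.
by rewrite e1 e2 e3 !mulr0 subr0 addr0.
Qed.

Variable k : fieldType.
Hypothesis char0 : [pchar k] =i pred0.
Local Notation S := {poly k}.
Local Notation R := {poly {poly k}}.
Local Notation B := {poly {poly {poly k}}}.

(** The left side has degree at most one in [w] and the right side starts at [w ^ 2], so both
    vanish, and characteristic zero recovers the multiplicities. *)
Lemma corner_weight_inj i j i' j' (mu : S) :
  (j%:R * (1 - 'X) + i%:R * (1 + 'X)) - (j'%:R * (1 - 'X) + i'%:R * (1 + 'X)) = 'X^2 * mu ->
  [/\ i = i', j = j' & mu = 0].
Proof.
move=> e; have e0 := congr1 (coefp 0) e; have e1 := congr1 (coefp 1) e.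
move: e0 e1; rewrite /coefp -!polyC_natr !coefXnM.
rewrite !(coefD, coefCM, coefN, coef1, coefX) /= => e0 e1.
have inj2 : injective (fun n => 2%:R * n%:R : k).
  by move=> m n; rewrite -!natrM => /(natr_inj char0); lia.
have ii : i = i'.
  have z : 2%:R * i%:R - 2%:R * i'%:R = 0 :> k by rewrite -[RHS]addr0 -{1}e0 -e1; ring.
  by apply: inj2; apply/eqP; rewrite -subr_eq0 z.
have jj : j = j'.
  have z : 2%:R * j%:R - 2%:R * j'%:R = 0 :> k by rewrite -[RHS]subr0 -{1}e0 -e1; ring.
  by apply: inj2; apply/eqP; rewrite -subr_eq0 z.
split=> //; apply/eqP; move: e; rewrite ii jj subrr => /esym/eqP.
by rewrite mulf_eq0 expf_eq0 polyX_eq0.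
Qed.

Lemma corner_const (c : R) : corner k c%:P = c.[0].
Proof. by rewrite /corner /= /horner_eval hornerC. Qed.

Definition wpoly (mu : S) : B := mu%:P%:P.

(** The Bezout identity shows that [P] divides ['X^e * r * delta P], and [x] can be cancelled
    because it does not divide [P]. So [P], and likewise [Q], is a Darboux polynomial up to the
    factor [r]. By [corner_monomial] they have equal orders, with [i = 0], and removing [y ^ j] from
    both leaves polynomials that are nonzero at the corner. *)
Lemma corner_rep_primitive (P Q u v : B) e (r : R) (mu : S) :
  P != 0 -> Q != 0 -> u * P + v * Q = ('X^e * r)%:P -> r.[0] != 0 ->
  (swapB k P).[0] != 0 ->
  delta P * Q - P * delta Q = wpoly ('X^2 * mu) * (P * Q) ->
  mu = 0 /\ exists P' Q', [/\ P * Q' = Q * P', corner k P' != 0 & corner k Q' != 0].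
Proof.
move=> P0 Q0 uv r0 sP rel; set m := wpoly _ in rel.
have [M ME] : exists M, r%:P * delta P = P * M.
  have rM : ('X^e * r)%:P * delta P = P * (u * delta P + v * (delta Q + m * Q)).
    rewrite -uv; apply/eqP; rewrite -subr_eq0; apply/eqP.
    transitivity (v * (delta P * Q - P * delta Q - m * (P * Q))); first by ring.
    by rewrite rel subrr mulr0.
  (* The swap makes [x] the outermost variable, to which [Xn_dvd] applies. *)
  have := congr1 (swapB k) rM; rewrite !(rmorphM (swapB k)) polyCM polyC_exp.
  have -> : swapB k (('X : R)%:P ^+ e * r%:P) = 'X^e * swapB k r%:P.
    have [ex _ _ _] := bevE (@Bconst k) (@By k) (@Bx k) (- (@Bw k)).
    by rewrite (rmorphM (swapB k)) (rmorphXn (swapB k)); congr (_ ^+ _ * _); exact: ex.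
  rewrite -mulrA => /Xn_dvd/(_ sP)[M' M'E].
  exists (swapB k M').
  have [_ ey _ _] := bevE (@Bconst k) (@By k) (@Bx k) (- (@Bw k)).
  have {M'E} M'E : u * delta P + v * (delta Q + m * Q) = @Bx k ^+ e * swapB k M'.
    rewrite -[LHS](@swapBK k) M'E (rmorphM (swapB k)) (rmorphXn (swapB k)).
    by congr (_ ^+ _ * _); exact: ey.
  apply: (@mulfI _ (@Bx k ^+ e)); first by rewrite expf_neq0 // polyC_eq0 polyX_eq0.
  rewrite [LHS]mulrA.
  have -> : @Bx k ^+ e * r%:P = ('X^e * r)%:P by rewrite polyCM polyC_exp.
  by rewrite rM M'E; ring.
have NE : r%:P * delta Q = Q * (M - r%:P * m).
  apply: (mulfI P0).
  transitivity (r%:P * delta P * Q - r%:P * (delta P * Q - P * delta Q)); first by ring.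
  by rewrite ME rel; ring.
have cr : corner k r%:P != 0 by rewrite corner_const.
have [i [j [G [cM GE G0 Gc [H HE H0]]]]] := corner_monomial char0 ME cr P0.
have [i' [j' [G' [cN G'E G'0 G'c _]]]] := corner_monomial char0 NE cr Q0.
have cm : corner k m = 'X^2 * mu by rewrite corner_const hornerC.
rewrite (rmorphB (corner k)) (rmorphM (corner k)) cm cM -mulrBr in cN.
have /corner_weight_inj[ii jj mu0] :
    (j%:R * (1 - 'X) + i%:R * (1 + 'X)) - (j'%:R * (1 - 'X) + i'%:R * (1 + 'X)) = 'X^2 * mu.
  by rewrite -(mulfI cr cN); ring.
have i0 : i = 0%N.
  by case: (i) HE => // n HE; move: sP; rewrite HE hornerM hornerXn expr0n mul0r eqxx.
split=> //; exists G, G'; split; [|exact: Gc | by apply: G'c; rewrite -ii].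
by rewrite GE {1}G'E -jj; ring.
Qed.

(** A fraction with logarithmic derivative in [w ^ 2 k[w]] is a first integral and restricts to a
    nonzero rational function of [w] at the corner. A coprime representation is divided by the
    common power of [x] to reach the primitive case. *)
Lemma corner_rep (P Q : B) (mu : S) :
  P != 0 -> Q != 0 ->
  delta P * Q - P * delta Q = wpoly ('X^2 * mu) * (P * Q) ->
  mu = 0 /\ exists P' Q', [/\ P * Q' = Q * P', corner k P' != 0 & corner k Q' != 0].
Proof.
move=> P0 Q0 rel; have dd := @delta_der k.
have [P1 [Q1 [u [v [r [e1 uv r0]]]]]] := coprime_rep P0 Q0.
have rP : r%:P != 0 :> B by rewrite polyC_eq0.
have Q10 : Q1 != 0.
  apply: contra_neq rP => Q10; move/eqP: e1; rewrite Q10 mulr0 eq_sym mulf_eq0 (negbTE Q0).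
  by move=> /eqP P10; rewrite -uv Q10 P10 !mulr0 addr0.
have P10 : P1 != 0.
  apply: contra_neq Q10 => P10; move/eqP: e1; rewrite P10 mulr0 mulf_eq0 (negbTE P0).
  by move/eqP.
have s0 (G : B) : G != 0 -> swapB k G != 0.
  by apply: contra_neq => sG; rewrite -[G](@swapBK k) sG rmorph0.
have sX n (G : B) : swapB k ('X^n * G) = @Bx k ^+ n * swapB k G.
  have [_ ey _ _] := bevE (@Bconst k) (@By k) (@Bx k) (- (@Bw k)).
  by rewrite (rmorphM (swapB k)) (rmorphXn (swapB k)); congr (_ ^+ _ * _); exact: ey.
have [e [r1 [rE r10]]] := X_order r0.
have [a [P2 [P2E P20]]] := X_order (s0 _ P10).
have [b [Q2 [Q2E Q20]]] := X_order (s0 _ Q10).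
have {P2E} P2E : P1 = @Bx k ^+ a * swapB k P2 by rewrite -sX -P2E swapBK.
have {Q2E} Q2E : Q1 = @Bx k ^+ b * swapB k Q2 by rewrite -sX -Q2E swapBK.
have Bx1 : @Bx k != 0 by rewrite /Bx polyC_eq0 polyX_eq0.
have Bx0 n : @Bx k ^+ n != 0 by apply: expf_neq0.
(* Here [a] and [b] are the orders of [P1] and [Q1] along [x = 0]. Inverting the fraction exchanges
   them and negates [mu]. *)
wlog le_ab : P Q mu P0 Q0 rel P1 Q1 u v e1 uv Q10 P10 a b P2 Q2 P20 Q20 P2E Q2E / (a <= b)%N.
  move=> W; case/orP: (leq_total a b) => le;
    first exact: (W P Q mu P0 Q0 rel P1 Q1 u v e1 uv Q10 P10 a b P2 Q2 P20 Q20 P2E Q2E le).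
  have rel' : delta Q * P - Q * delta P = wpoly ('X^2 * - mu) * (Q * P).
    by rewrite mulrN /wpoly !polyCN mulNr [Q * P]mulrC -rel; ring.
  have uv' : v * Q1 + u * P1 = r%:P by rewrite addrC.
  have [mu0 [P' [Q' [PQ cP cQ]]]] :=
    W Q P (- mu) Q0 P0 rel' Q1 P1 v u (esym e1) uv' P10 Q10 b a Q2 P2 Q20 P20 Q2E P2E le.
  split; first by apply/eqP; rewrite -oppr_eq0 mu0.
  by exists Q', P'.
pose P3 := swapB k P2; pose Q3 := @Bx k ^+ (b - a) * swapB k Q2.
have Q3E : Q1 = @Bx k ^+ a * Q3 by rewrite Q2E /Q3 mulrA -exprD subnKC.
have P30 : P3 != 0 by apply: contra_neq P10 => P30; rewrite P2E -/P3 P30 mulr0.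
have Q30 : Q3 != 0 by apply: contra_neq Q10 => Q30; rewrite Q3E Q30 mulr0.
have e3 : P * Q3 = Q * P3.
  apply: (mulfI (Bx0 a)); rewrite mulrCA -Q3E e1 P2E -/P3; ring.
have uv3 : u * @Bx k ^+ a * P3 + v * @Bx k ^+ a * Q3 = ('X^e * r1)%:P.
  by rewrite -rE -uv P2E Q3E -/P3; ring.
have sP3 : (swapB k P3).[0] != 0 by rewrite swapBK.
have rel3 := relation_transfer dd P0 Q0 e3 rel.
have [mu0 [P' [Q' [PQ cP cQ]]]] := corner_rep_primitive P30 Q30 uv3 r10 sP3 rel3.
split=> //; exists P', Q'; split=> //.
apply: (mulfI P30); rewrite mulrCA PQ mulrA e3; ring.
Qed.

End CornerRepresentation.

(** * Transport around the triangle *)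

Section Periodicity.
Variable k : fieldType.
Hypothesis char0 : [pchar k] =i pred0.
Local Notation S := {poly k}.
Local Notation R := {poly {poly k}}.
Local Notation B := {poly {poly {poly k}}}.

Lemma natr_poly_neq0 n : (n.+1%:R : S) != 0.
Proof. by rewrite -polyC_natr polyC_eq0 ((pcharf0P k).1 char0). Qed.

(** The fraction [f/g] has derivative zero, so it equals its value at 0: otherwise the difference
    [r] has some order [n.+1], and the lowest terms of [r' g = r g'] give a contradiction as [n.+1]
    is nonzero in [k]. *)
Lemma wronskian0 (f g : R) :
  f^`() * g = f * g^`() -> g.[0] != 0 -> f * (g.[0])%:P = g * (f.[0])%:P.
Proof.
move=> fg g0; apply/eqP; rewrite -subr_eq0; apply: contraT => r0.
have [n [q [rE q0]]] := X_order r0; move: rE; set r := _ - _ => rE.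
have rg : r^`() * g = r * g^`().
  rewrite /r derivB !derivM !derivC !mulr0 !addr0.
  transitivity (f^`() * g * (g.[0])%:P - g^`() * g * (f.[0])%:P); first by ring.
  by rewrite fg; ring.
have : r.[0] = 0 by rewrite /r hornerD hornerN !hornerM !hornerC; ring.
case: n rE => [|n] rE; first by rewrite rE expr0 mul1r => /eqP; rewrite (negbTE q0).
move=> _; move: rg; rewrite rE derivM derivXn /= -mulr_natl => rg.
have {}rg : (n.+1%:R * q + 'X * q^`()) * g = 'X * q * g^`().
  apply: (@mulfI _ ('X^n)); first by rewrite expf_neq0 // polyX_eq0.
  transitivity ('X^(n.+1) * q * g^`()); last by rewrite exprS; ring.
  by rewrite -rg exprS; ring.
have := congr1 (horner_eval (0 : S)) rg.
rewrite !(rmorphM, rmorphD, rmorph_nat) /= /horner_eval hornerX !mul0r addr0 => /eqP.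
by rewrite !mulf_eq0 (negbTE (natr_poly_neq0 _)) (negbTE q0) (negbTE g0).
Qed.

(** The fraction [P/Q] restricts to [a/b] at the corner. The representing pair is free, so only the
    quotient is determined. *)
Definition corner_val (P Q : B) (a b : S) :=
  exists P0 Q0, [/\ P * Q0 = Q * P0, corner k P0 = a, corner k Q0 = b, a != 0 & b != 0].

(** The rotation carries the corner [x = y = 0] to the other end [x = 1] of the edge [y = 0]. *)
Lemma corner_rot p : corner k (rotB k p) = p.[0].[1].
Proof.
have [ex ey ew ec] := bevE (@Bconst k) (1 - @Bx k - @By k) (@Bx k) (@Bw k).
have H : corner k \o rotB k =1 horner_eval (1 : S) \o horner_eval (0 : R).
  apply: bev_ext => [|||c]; rewrite /= /rotB ?ex ?ey ?ew ?ec /horner_eval /Bx /By /Bw /=.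
  - by rewrite !(hornerD, hornerN, hornerX, hornerC) !subr0.
  - by rewrite !(hornerX, hornerC).
  - by rewrite !hornerC.
  - by rewrite !hornerC.
exact: H.
Qed.

(* On the edge [y = 0] the flow is a multiple of [d/dx] along the lines
   [w - 2 x = const]. *)
Definition edge_line : {rmorphism R -> R} :=
  pev (pev (polyC \o polyC) ('X%:P + 2%:R * 'X)) 'X.

Lemma edge_line_deriv r :
  edge_line (r^`() + 2%:R * der_poly (@deriv _) 0 r) = (edge_line r)^`().
Proof.
have d1 := @deriv_derivation S; have d2 := der_polyP 0 (@deriv_derivation k).
have d := der_comb 1 2%:R d1 d2.
have -> : r^`() + 2%:R * der_poly (@deriv _) 0 r = 1 * r^`() + 2%:R * der_poly (@deriv _) 0 r.
  by rewrite mul1r.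
apply: (@der_hom_poly _ _ edge_line _ (@deriv _) d d1) => [a|]; last first.
  by rewrite derivX der_polyX ?scale0r; [rewrite pevX derivX mulr0 addr0 mulr1 rmorph1 |
     exact: deriv_derivation].
rewrite derivC mulr0 add0r der_polyC; last exact: deriv_derivation.
rewrite rmorphM rmorph_nat !pevC; elim/poly_ind: a => [|p c IHp].
  by rewrite deriv0 !rmorph0 derivC mulr0.
have hX := pevX (polyC \o polyC) ('X%:P + 2%:R * 'X : R).
have hC := pevC (polyC \o polyC) ('X%:P + 2%:R * 'X : R).
move: (pev _ _) hX hC IHp => h hX hC IHp.
rewrite derivD derivC addr0 derivM derivX mulr1 !(rmorphD h) !(rmorphM h) hX hC.
rewrite derivD derivC addr0 derivM -IHp derivD derivC add0r derivM derivX.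
by rewrite -[2%:R in X in _ = X]polyC_natr derivC polyC_natr; ring.
Qed.

Lemma edge_line0 r : (edge_line r).[0] = r.[0].
Proof.
have H : horner_eval (0 : S) \o edge_line =1 horner_eval (0 : S).
  apply: rmorph_poly_ext => [a|]; last by rewrite /= /horner_eval pevX hornerX.
  have H' : (horner_eval (0 : S) \o edge_line) \o polyC =1 horner_eval (0 : S) \o polyC.
    apply: rmorph_poly_ext => [c|]; rewrite /= /horner_eval /edge_line !pevC ?pevX /=.
      by rewrite !hornerC.
    by rewrite hornerD hornerM hornerX mulr0 addr0.
  exact: H'.
exact: H.
Qed.

(** Following the line from [x = 0] to [x = 1] increases [w] by 2; this is the source of the
    shift. *)
Lemma edge_line1 r : (edge_line r).[1] = r.[1] \Po ('X + 2%:R%:P).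
Proof.
have H : horner_eval (1 : S) \o edge_line =1 comp_poly ('X + 2%:R%:P) \o horner_eval (1 : S).
  apply: rmorph_poly_ext => [a|]; last first.
    by rewrite /= /horner_eval pevX !hornerX -polyC1 comp_polyC.
  have H' : (horner_eval (1 : S) \o edge_line) \o polyC =1
      (comp_poly ('X + 2%:R%:P) \o horner_eval (1 : S)) \o polyC.
    apply: rmorph_poly_ext => [c|]; rewrite /= /horner_eval /edge_line !pevC ?pevX /=.
      by rewrite !hornerC comp_polyC.
    rewrite hornerD hornerM hornerX mulr1 !hornerC comp_polyX; congr (_ + _).
    by rewrite -polyC_natr hornerC polyC_natr.
  exact: H'.
exact: H.
Qed.

(** On each line the fraction [p/q] is constant, so its values at the two ends agree. A second
    representation [p'/q'] is read at [x = 1], where [p] and [q] may both vanish. *)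
Lemma edge_proportional (p q p' q' : R) a b a' b' :
  edge_der p * q = p * edge_der q -> p * q' = q * p' ->
  p.[0] = a -> q.[0] = b -> b != 0 -> p'.[1] = a' -> q'.[1] = b' ->
  (a' \Po ('X + 2%:R%:P)) * b = (b' \Po ('X + 2%:R%:P)) * a.
Proof.
move=> rel1 e13 aP bP b0 q3 p3.
have {}rel1 : (edge_line p)^`() * edge_line q = edge_line p * (edge_line q)^`().
  rewrite -!edge_line_deriv -!rmorphM; congr (edge_line _).
  pose c : R := 'X * (1 - 'X) * ('X%:P + 1 - 2%:R * 'X).
  have c0 : c != 0.
    rewrite !mulf_neq0 ?polyX_eq0 //.
      by rewrite -oppr_eq0 opprB -polyC1 polyXsubC_eq0.
    apply/eqP => /(congr1 (horner_eval (0 : S))).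
    rewrite rmorph0 /= /horner_eval hornerD hornerN hornerM hornerX mulr0 subr0.
    rewrite hornerD !hornerC => /(congr1 (horner_eval 0)).
    by rewrite /horner_eval hornerD hornerX !hornerC add0r => /eqP; rewrite oner_eq0.
  apply: (mulfI c0); rewrite mulrA -[c * _]/(edge_der p) rel1 /edge_der -/c; ring.
have q0 : (edge_line q).[0] != 0 by rewrite edge_line0 bP.
have := wronskian0 rel1 q0; rewrite !edge_line0 aP bP => pq.
have {e13} e13 : edge_line p * edge_line q' = edge_line q * edge_line p'.
  by rewrite -!rmorphM e13.
have lq0 : edge_line q != 0 by apply: contra_neq q0 => ->; rewrite horner0.
have : edge_line p' * b%:P = edge_line q' * a%:P.
  apply: (mulfI lq0); rewrite mulrA -e13 mulrAC pq; ring.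
move/(congr1 (horner_eval (1 : S))); rewrite !rmorphM /= /horner_eval.
by rewrite !edge_line1 !hornerC q3 p3.
Qed.

Lemma edge_shift (P Q : B) a b a' b' :
  P != 0 -> Q != 0 -> delta P * Q - P * delta Q = 0 ->
  corner_val P Q a b -> corner_val (rotB k P) (rotB k Q) a' b' ->
  (a' \Po ('X + 2%:R%:P)) * b = (b' \Po ('X + 2%:R%:P)) * a.
Proof.
move=> P0 Q0 rel [P1 [Q1 [e1 aE bE a0 b0]]] [P2 [Q2 [e2 aE' bE' a0' b0']]].
(* Two more rotations bring the second pair back to the coordinates of [P] and [Q]. *)
pose P3 := rotB k (rotB k P2); pose Q3 := rotB k (rotB k Q2).
have e3 : P * Q3 = Q * P3.
  rewrite /P3 /Q3; move: (rotB k) (@rotBK k) e2 => h hK e2.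
  by have := congr1 h (congr1 h e2); rewrite !rmorphM !hK.
have e13 : P1 * Q3 = Q1 * P3.
  apply: (mulfI Q0); apply: (mulfI P0).
  transitivity (P * Q3 * (Q * P1)); first by ring.
  by rewrite e3 -e1; ring.
have rel1 : delta P1 * Q1 = P1 * delta Q1.
  have rel' : delta P * Q - P * delta Q = 0 * (P * Q) by rewrite mul0r.
  have := relation_transfer (@delta_der k) P0 Q0 e1 rel'.
  by rewrite mul0r => /eqP; rewrite subr_eq0 => /eqP.
have {e13} e13 : P1.[0] * Q3.[0] = Q1.[0] * P3.[0] by rewrite -!hornerM e13.
have {}rel1 : edge_der P1.[0] * Q1.[0] = P1.[0] * edge_der Q1.[0].
  have := congr1 (horner_eval (0 : R)) rel1.
  have := delta_edge P1; have := delta_edge Q1.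
  move: (delta P1) (delta Q1) => D1 D2 E2 E1.
  by rewrite !rmorphM /= /horner_eval E1 E2.
have aP : P1.[0].[0] = a by exact: aE.
have bP : Q1.[0].[0] = b by exact: bE.
have q3 : P3.[0].[1] = a' by rewrite -corner_rot rotBK.
have p3 : Q3.[0].[1] = b' by rewrite -corner_rot rotBK.
exact: (edge_proportional rel1 e13 aP bP b0 q3 p3).
Qed.

Lemma eventually_nonroot (u : nat -> k) (p : S) :
  injective u -> p != 0 -> exists N, forall n, (N <= n)%N -> p.[u n] != 0.
Proof.
move=> uI; have [m] := ubnP (size p); elim: m p => // m IHm p ltpm p0.
have [nr|[n0 pn0]] : (forall n, p.[u n] != 0) \/ exists n, p.[u n] = 0.
- have [H|] := pselect (exists n, p.[u n] = 0); first by right.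
  by move/forallNP => H; left => n; apply/eqP.
- by exists 0%N => n _.
have /factor_theorem[q pE] : root p (u n0) by rewrite rootE pn0.
have q0 : q != 0 by apply: contra_neq p0 => q0; rewrite pE q0 mul0r.
have [|N HN] := IHm q _ q0.
  by move: ltpm; rewrite pE size_Mmonic ?monicXsubC // size_XsubC addn2.
exists (maxn N n0.+1) => n; rewrite geq_max => /andP[/HN qn n0n].
rewrite pE hornerM mulf_neq0 // hornerXsubC subr_eq0.
by apply: contraTneq n0n => /uI ->; rewrite ltnn.
Qed.

(** Beyond the multiples of [c] that are roots of [b], the fraction [a/b] takes the same value [e]
    at all further multiples. These are infinitely many points in characteristic zero, so
    [a - e *: b] is zero. *)
Lemma periodic_const (a b : S) (c : k) : c != 0 -> b != 0 ->
  (a \Po ('X + c%:P)) * b = (b \Po ('X + c%:P)) * a -> exists e, a = e *: b.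
Proof.
move=> c0 b0 ab; pose u n : k := n%:R * c.
have uI : injective u by move=> m n /(mulIf c0)/(natr_inj char0).
have [N HN] := eventually_nonroot uI b0.
pose e := a.[u N] / b.[u N]; exists e.
apply/eqP; rewrite -subr_eq0; apply: contraT => r0.
have [M HM] := eventually_nonroot uI r0.
have z n : (a - e *: b).[u (N + n)%N] = 0.
  elim: n => [|n IHn]; first by rewrite addn0 hornerD hornerN hornerZ divfK ?subrr // HN.
  have us : u (N + n.+1)%N = ('X + c%:P).[u (N + n)%N].
    by rewrite hornerD hornerX hornerC /u addnS -natr1; ring.
  apply: (mulIf (HN (N + n)%N (leq_addr _ _))); rewrite mul0r.
  transitivity (b.[u (N + n.+1)%N] * (a - e *: b).[u (N + n)%N]); last by rewrite IHn mulr0.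
  rewrite !hornerD !hornerN !hornerZ us -!horner_comp.
  rewrite !(mulrBl, mulrBr); congr (_ - _); last by ring.
  by rewrite -!hornerM ab.
by have := HM (N + M)%N (leq_addl _ _); rewrite z eqxx.
Qed.

Lemma rotB_neq0 P : P != 0 -> rotB k P != 0.
Proof. by apply: contra_neq => r0; rewrite -[P]rotBK r0 !rmorph0. Qed.

Lemma rotB_relation (P Q : B) : delta P * Q - P * delta Q = 0 ->
  delta (rotB k P) * rotB k Q - rotB k P * delta (rotB k Q) = 0.
Proof.
move: (rotB k) (@rotB_delta k) => h hd /(congr1 h).
by rewrite rmorphB !rmorphM !hd rmorph0.
Qed.

Lemma corner_val_exists (P Q : B) : P != 0 -> Q != 0 ->
  delta P * Q - P * delta Q = 0 -> exists a b, corner_val P Q a b.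
Proof.
move=> P0 Q0 rel.
have [|_ [P' [Q' [e cP cQ]]]] := @corner_rep k char0 P Q 0 P0 Q0.
  by rewrite rel mulr0 /wpoly !polyC0 mul0r.
by exists (corner k P'), (corner k Q'), P', Q'; split.
Qed.

(* Going around the triangle shifts [w] by [2] on each of the three edges. *)
Lemma corner_val_const (P Q : B) a b : P != 0 -> Q != 0 ->
  delta P * Q - P * delta Q = 0 -> corner_val P Q a b -> exists e, a = e *: b.
Proof.
move=> P0 Q0 rel v0; have [P1 Q1] := (rotB_neq0 P0, rotB_neq0 Q0).
have [P2 Q2] := (rotB_neq0 P1, rotB_neq0 Q1).
have rel1 := rotB_relation rel; have rel2 := rotB_relation rel1.
have [a1 [b1 v1]] := corner_val_exists P1 Q1 rel1.
have [a2 [b2 v2]] := corner_val_exists P2 Q2 rel2.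
have s1 := edge_shift P0 Q0 rel v0 v1.
have s2 := edge_shift P1 Q1 rel1 v1 v2.
(* The third rotation is the identity, so the initial value is also the final one. *)
have v3 := v0; rewrite -(rotBK P) -(rotBK Q) in v3.
have s3 := edge_shift P2 Q2 rel2 v2 v3.
have [_ [_ [_ _ _ _ b0]]] := v0.
have [_ [_ [_ _ _ _ b10]]] := v1; have [_ [_ [_ _ _ _ b20]]] := v2.
have sh (n m : nat) (p : S) :
    (p \Po ('X + n%:R%:P)) \Po ('X + m%:R%:P) = p \Po ('X + (n + m)%:R%:P).
  rewrite -comp_polyA comp_polyD comp_polyX comp_polyC natrD polyCD; congr (_ \Po _); ring.
have s0 n (p : S) : p != 0 -> p \Po ('X + n%:R%:P) != 0.
  apply: contra_neq => /(congr1 (comp_poly ('X - n%:R%:P))); rewrite comp_poly0 => <-.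
  by rewrite -comp_polyA comp_polyD comp_polyX comp_polyC subrK comp_polyXr.
(* Shifting the second and third relations by 2 and 4 makes the product of the three telescope to a
   relation of period 6. *)
have {}s2 := congr1 (comp_poly ('X + 2%:R%:P)) s2.
have {}s3 := congr1 (comp_poly ('X + 4%:R%:P)) s3.
rewrite !comp_polyM !sh /= in s2 s3.
have c6 : (6%:R : k) != 0 by rewrite ((pcharf0P k).1 char0).
apply: (periodic_const c6 b0).
apply: (mulfI (s0 2 _ b10)); apply: (mulfI (s0 4 _ b20)).
transitivity ((a \Po ('X + 6%:R%:P)) * (b2 \Po ('X + 4%:R%:P)) * (b1 \Po ('X + 2%:R%:P)) * b).
  by ring.
rewrite s3.
transitivity ((b \Po ('X + 6%:R%:P)) * ((a2 \Po ('X + 4%:R%:P)) * (b1 \Po ('X + 2%:R%:P))) * b).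
  by ring.
rewrite s2.
transitivity ((b \Po ('X + 6%:R%:P)) * (b2 \Po ('X + 4%:R%:P)) *
  ((a1 \Po ('X + 2%:R%:P)) * b)); first by ring.
by rewrite s1; ring.
Qed.

(** The corner value is a constant [e]. If [P - e Q] were nonzero, its quotient by [Q] would be a
    first integral with nonzero corner value, but it restricts to 0. *)
Lemma delta_first_integral (P Q : B) (mu : S) :
  P != 0 -> Q != 0 ->
  delta P * Q - P * delta Q = wpoly ('X^2 * mu) * (P * Q) ->
  mu = 0 /\ exists e, P = Bconst k e * Q.
Proof.
move=> P0 Q0 rel; have [mu0 [P1 [Q1 [e1 cP cQ]]]] := corner_rep char0 P0 Q0 rel.
split=> //; rewrite mu0 mulr0 /wpoly !polyC0 mul0r in rel.
have v : corner_val P Q (corner k P1) (corner k Q1) by exists P1, Q1; split.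
have [e eE] := corner_val_const P0 Q0 rel v; exists e.
apply/eqP; rewrite -subr_eq0; apply: contraT; set T := P - _ => T0.
have dT : delta T * Q - T * delta Q = 0.
  have dd := @delta_der k; have [_ _ _ dc] := deltaE k.
  rewrite /T (derB dd) dd.2 dc mul0r add0r -[RHS]rel; ring.
have [a [b [T1 [Q2 [e2 aE bE a0 b0]]]]] := corner_val_exists T0 Q0 dT.
have e3 : T1 * Q1 = Q2 * (P1 - Bconst k e * Q1).
  apply: (mulfI Q0); rewrite mulrA -e2 /T.
  transitivity (Q2 * (P * Q1 - Bconst k e * Q * Q1)); first by ring.
  by rewrite e1; ring.
have := congr1 (corner k) e3; rewrite !(rmorphM (corner k), rmorphB (corner k)) eE.
have -> : corner k (Bconst k e) = e%:P by rewrite corner_const hornerC.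
rewrite mul_polyC subrr mulr0 aE => /eqP; rewrite mulf_eq0 (negbTE a0) /=.
by rewrite (negbTE cQ).
Qed.

End Periodicity.

(** * Doubling *)

Section Doubling.

(** The numerator of the correction to [2 w] when the point is doubled in the universal vector
    extension. *)
Definition dbl_num (R : comNzRingType) (x y z : R) : R :=
  let e2 := x * y + y * z + z * x in
  6%:R * e2 * e2 - e2 - 9%:R * x * y * z.

Variables (F : fieldType) (x y w : F).
Let z := 1 - x - y.
Hypotheses (xy : x - y != 0) (yz : y - z != 0) (zx : z - x != 0).
Let X := z * (x - y) ^+ 2 / ((z - x) * (y - z)).
Let Y := y * (z - x) ^+ 2 / ((y - z) * (x - y)).
Let W := 2%:R * w + dbl_num x y z / ((x - y) * (y - z) * (z - x)).
Let dx := x * field_x x y w.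
Let dy := y * field_y x y w.
Let dw := field_w x y w.
Let dz := - dx - dy.

(** The hypothesis is the quotient rule for [X] with denominators cleared. This and the next two
    lemmas say that doubling maps solutions to solutions; each is an identity of rational
    functions. *)
Lemma doubling_field_x (dX : F) :
  dX * ((z - x) * (y - z)) + X * ((dz - dx) * (y - z) + (z - x) * (dy - dz)) =
  dz * (x - y) ^+ 2 + 2%:R * z * (x - y) * (dx - dy) ->
  dX = X * field_x X Y W.
Proof.
move/(canRL (addrK _)) => e.
have den : (z - x) * (y - z) != 0 by rewrite mulf_neq0.
apply: (mulIf den); rewrite {}e.
rewrite /X /Y /W /dz /dx /dy /field_x /field_y /dbl_num /z.
move: yz zx; rewrite /z => yz' zx'.
by field; rewrite xy yz' zx'.
Qed.

Lemma doubling_field_y (dY : F) :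
  dY * ((y - z) * (x - y)) + Y * ((dy - dz) * (x - y) + (y - z) * (dx - dy)) =
  dy * (z - x) ^+ 2 + 2%:R * y * (z - x) * (dz - dx) ->
  dY = Y * field_y X Y W.
Proof.
move/(canRL (addrK _)) => e.
have den : (y - z) * (x - y) != 0 by rewrite mulf_neq0.
apply: (mulIf den); rewrite {}e.
rewrite /X /Y /W /dz /dx /dy /field_x /field_y /dbl_num /z.
move: yz zx; rewrite /z => yz' zx'.
by field; rewrite xy yz' zx'.
Qed.

Lemma doubling_field_w (dW : F) :
  let e2 := x * y + y * z + z * x in
  let de2 := dx * (y + z) + dy * (x + z) + dz * (x + y) in
  (dW - 2%:R * dw) * ((x - y) * (y - z) * (z - x)) + (W - 2%:R * w) *
    ((dx - dy) * (y - z) * (z - x) + (x - y) * ((dy - dz) * (z - x) + (y - z) * (dz - dx))) =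
  12%:R * e2 * de2 - de2 - 9%:R * (dx * y * z + x * dy * z + x * y * dz) ->
  dW = field_w X Y W.
Proof.
move=> e2 de2 /(canRL (addrK _)) e.
have den : (x - y) * (y - z) * (z - x) != 0 by rewrite !mulf_neq0.
apply: (addIr (- (2%:R * dw))); apply: (mulIf den); rewrite {}e.
rewrite /e2 /de2 /X /Y /W /dz /dx /dy /dw /field_x /field_y /field_w /dbl_num /z.
move: yz zx; rewrite /z => yz' zx'.
by field; rewrite xy yz' zx'.
Qed.

End Doubling.

(** * Formal power series *)

Record fps (k : fieldType) := Fps { fcoef : nat -> k }.

Section PowerSeries.
Variable k : fieldType.
Local Notation L := (fps k).

HB.instance Definition _ := gen_eqMixin L.
HB.instance Definition _ := gen_choiceMixin L.

Lemma fpsP (a b : L) : (forall n, fcoef a n = fcoef b n) -> a = b.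
Proof. by case: a b => [f] [g] /= fg; congr Fps; apply: funext. Qed.

Definition fps_const (c : k) : L := Fps (fun n => if n == 0%N then c else 0).
Definition fps_add (a b : L) : L := Fps (fun n => fcoef a n + fcoef b n).
Definition fps_opp (a : L) : L := Fps (fun n => - fcoef a n).
Definition fps_mul (a b : L) : L := Fps (fun n => \sum_(i < n.+1) fcoef a i * fcoef b (n - i)).

Fact fps_addA : associative fps_add.
Proof. by move=> a b c; apply: fpsP => n; rewrite /= addrA. Qed.
Fact fps_addC : commutative fps_add.
Proof. by move=> a b; apply: fpsP => n; rewrite /= addrC. Qed.
Fact fps_add0 : left_id (fps_const 0) fps_add.
Proof. by move=> a; apply: fpsP => n; rewrite /= if_same add0r. Qed.
Fact fps_addN : left_inverse (fps_const 0) fps_opp fps_add.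
Proof. by move=> a; apply: fpsP => n; rewrite /= if_same addNr. Qed.

HB.instance Definition _ := GRing.isZmodule.Build L fps_addA fps_addC fps_add0 fps_addN.

Lemma fps_mul_poly (a b : L) (p q : {poly k}) n :
  (forall i, (i <= n)%N -> p`_i = fcoef a i) ->
  (forall i, (i <= n)%N -> q`_i = fcoef b i) ->
  (p * q)`_n = fcoef (fps_mul a b) n.
Proof.
move=> pa qb; rewrite coefM; apply: eq_bigr => i _.
by rewrite pa ?qb ?leq_subr // -ltnS.
Qed.

Definition fps_trunc n (a : L) : {poly k} := \poly_(i < n.+1) fcoef a i.

Lemma coef_fps_trunc n a i : (i <= n)%N -> (fps_trunc n a)`_i = fcoef a i.
Proof. by move=> le_in; rewrite coef_poly ltnS le_in. Qed.

Fact fps_mulA : associative fps_mul.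
Proof.
move=> a b c; apply: fpsP => n; have T := @coef_fps_trunc n.
rewrite -(@fps_mul_poly a (fps_mul b c) (fps_trunc n a) (fps_trunc n b * fps_trunc n c)).
- rewrite mulrA (@fps_mul_poly (fps_mul a b) c) // => i le_in; last exact: T.
  by apply: fps_mul_poly => j le_ji; apply: T; apply: leq_trans le_in.
- by move=> i; apply: T.
- move=> i le_in; apply: fps_mul_poly => j le_ji; apply: T; exact: leq_trans le_in.
Qed.

Fact fps_mulC : commutative fps_mul.
Proof.
move=> a b; apply: fpsP => n; have T := @coef_fps_trunc n.
rewrite -(@fps_mul_poly _ _ (fps_trunc n a) (fps_trunc n b)) => [|i|i]; try exact: T.
by rewrite mulrC; apply: fps_mul_poly => i; apply: T.
Qed.

Fact fps_mul1 : left_id (fps_const 1) fps_mul.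
Proof.
move=> a; apply: fpsP => n; rewrite /= big_ord_recl /= subn0 mul1r big1 ?addr0 // => i _.
by rewrite mul0r.
Qed.

Fact fps_mulDl : left_distributive fps_mul fps_add.
Proof.
move=> a b c; apply: fpsP => n; rewrite /= -big_split; apply: eq_bigr => i _.
by rewrite mulrDl.
Qed.

Fact fps_one_neq0 : fps_const 1 != 0 :> L.
Proof. by apply/eqP => /(congr1 (fun a => fcoef a 0)) /eqP /=; rewrite oner_eq0. Qed.

HB.instance Definition _ := GRing.Zmodule_isComNzRing.Build L
  fps_mulA fps_mulC fps_mul1 fps_mulDl fps_one_neq0.

Lemma fcoefD (a b : L) n : fcoef (a + b) n = fcoef a n + fcoef b n. Proof. by []. Qed.
Lemma fcoefN (a : L) n : fcoef (- a) n = - fcoef a n. Proof. by []. Qed.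
Lemma fcoefM (a b : L) n :
  fcoef (a * b) n = \sum_(i < n.+1) fcoef a i * fcoef b (n - i).
Proof. by []. Qed.
Lemma fcoef0 n : fcoef (0 : L) n = 0. Proof. by rewrite /= if_same. Qed.
Lemma fcoef1 n : fcoef (1 : L) n = (n == 0%N)%:R. Proof. by rewrite /=; case: eqP. Qed.
Lemma fcoefM0 (a b : L) : fcoef (a * b) 0 = fcoef a 0 * fcoef b 0.
Proof. by rewrite fcoefM big_ord1 subn0. Qed.

(** The entry [n] of [T f] depends only on earlier entries of [f], so the iterates of [T] become
    stationary at index [n] after [n.+1] steps. *)
Lemma causal_fixpoint (X : Type) (x0 : X) (T : (nat -> X) -> nat -> X) :
  (forall m f g, (forall i, (i < m)%N -> f i = g i) ->
     forall i, (i <= m)%N -> T f i = T g i) ->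
  exists f, forall n, f n = T f n.
Proof.
move=> Tc; pose F m := iter m T (fun _ => x0).
have FF m : forall m' i, (i < m)%N -> (m <= m')%N -> F m i = F m' i.
  elim: m => // m IHm [//|m'] i; rewrite !ltnS => le_im le_mm.
  by apply: (Tc m) => // j lt_jm; apply: IHm.
exists (fun n => F n.+1 n) => n.
by apply: (Tc n) => // i lt_in; apply/esym; apply: FF.
Qed.

Lemma fps_inv_exists (a : L) : fcoef a 0 != 0 -> exists b : L, b * a = 1.
Proof.
move=> a0.
pose T (b : nat -> k) n := ((n == 0%N)%:R - \sum_(i < n) fcoef a i.+1 * b (n - i.+1)%N) / fcoef a 0.
have [|b bE] := @causal_fixpoint k 0 T.
  move=> m f g fg i le_im; rewrite /T; congr ((_ - _) / _); apply: eq_bigr => j _.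
  by rewrite fg //; have := ltn_ord j; lia.
exists (Fps b); rewrite mulrC; apply: fpsP => n.
rewrite fcoefM fcoef1 big_ord_recl subn0 /= bE /T mulrC divfK //.
by rewrite [X in _ - X](_ : _ = \sum_(i < n) fcoef a (bump 0 i) * b (n - bump 0 i)%N) ?subrK.
Qed.

Definition fps_unit : pred L := fun a => fcoef a 0 != 0.
(** The inverse is picked by choice; a non-unit is sent to itself, as the ring interface
    requires. *)
Definition fps_inv (a : L) : L :=
  if pselect (exists b, b * a = 1) is left e then projT1 (cid e) else a.

Fact fps_mulV : {in fps_unit, left_inverse 1 fps_inv *%R}.
Proof.
move=> a a0; rewrite /fps_inv; case: pselect => [e|[]]; first by case: cid.
exact: fps_inv_exists.
Qed.

Fact fps_unitP (a b : L) : b * a = 1 -> fps_unit a.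
Proof.
move=> /(congr1 (fun c : L => fcoef c 0)); rewrite fcoefM0 fcoef1 => ba.
by apply/eqP => a0; move/eqP: ba; rewrite a0 mulr0 eq_sym oner_eq0.
Qed.

Fact fps_inv_out : {in [predC fps_unit], fps_inv =1 id}.
Proof.
move=> a; rewrite inE => a0; rewrite /fps_inv; case: pselect => // e.
by case/negP: a0; case: e => b /fps_unitP.
Qed.

HB.instance Definition _ := GRing.ComNzRing_hasMulInverse.Build L
  fps_mulV fps_unitP fps_inv_out.

Definition fps_var : L := Fps (fun n => (n == 1%N)%:R).

Lemma fcoefXM (a : L) n : fcoef (fps_var * a) n = if n is m.+1 then fcoef a m else 0.
Proof.
rewrite fcoefM big_ord_recl /= mul0r add0r; case: n => [|n]; first by rewrite big_ord0.
rewrite big_ord_recl /= mul1r subn1 /= big1 ?addr0 // => i _.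
by rewrite mul0r.
Qed.

Lemma fcoefXnM m (a : L) n :
  fcoef (fps_var ^+ m * a) n = if (n < m)%N then 0 else fcoef a (n - m).
Proof.
elim: m n => [|m IHm] n; first by rewrite expr0 mul1r subn0.
by rewrite exprS -mulrA fcoefXM; case: n => [|n] //; rewrite IHm.
Qed.

Lemma fps_order (a : L) : a != 0 -> exists n b, a = fps_var ^+ n * b /\ fcoef b 0 != 0.
Proof.
move=> a0; have ex : exists n, fcoef a n != 0.
  apply: contrapT => /forallNP H; case/eqP: a0; apply: fpsP => n; rewrite fcoef0.
  by apply/eqP/negPn/negP; apply: H.
case: (ex_minnP ex) => n an nmin; exists n, (Fps (fun i => fcoef a (i + n))); split=> //.
apply: fpsP => i; rewrite fcoefXnM /=; case: ltnP => [lt_in|le_ni]; last by rewrite subnK.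
by apply/eqP/negPn/negP => /nmin; rewrite leqNgt lt_in.
Qed.

Fact fps_mul_eq0 (a b : L) : a * b = 0 -> (a == 0) || (b == 0).
Proof.
move=> ab; apply: contraT; rewrite negb_or => /andP[/fps_order[n [c [aE c0]]]].
case/fps_order => m [d [bE d0]].
have := congr1 (fun e : L => fcoef e (n + m)) ab; rewrite fcoef0 aE bE.
have -> : fps_var ^+ n * c * (fps_var ^+ m * d) = fps_var ^+ (n + m) * (c * d).
  by rewrite exprD; ring.
by rewrite fcoefXnM ltnn subnn fcoefM0 => /eqP; rewrite mulf_eq0 (negbTE c0) (negbTE d0).
Qed.

HB.instance Definition _ := GRing.ComUnitRing_isIntegral.Build L fps_mul_eq0.

Fact fps_const_zmod : zmod_morphism fps_const.
Proof. by move=> a b; apply: fpsP => -[|n] //=; rewrite subrr. Qed.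

Fact fps_const_monoid : monoid_morphism fps_const.
Proof.
split=> // a b; apply: fpsP => -[|n]; first by rewrite fcoefM0.
rewrite fcoefM big_ord_recl /= mulr0 big1 ?addr0 // => i _.
by rewrite /= mul0r.
Qed.

HB.instance Definition _ := GRing.isZmodMorphism.Build k L fps_const fps_const_zmod.
HB.instance Definition _ := GRing.isMonoidMorphism.Build k L fps_const fps_const_monoid.

Lemma fps_var_exp_neq0 n : fps_var ^+ n != 0.
Proof.
rewrite expf_neq0 //; apply/eqP => /(congr1 (fun a : L => fcoef a 1)) /eqP.
by rewrite fcoef0 /= oner_eq0.
Qed.

(** This is [(1/M) s d/ds]. *)
Definition fps_der (M : nat) (a : L) : L := Fps (fun n => n%:R / M%:R * fcoef a n).

Lemma fps_derP M : derivation (fps_der M).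
Proof.
split=> a b; apply: fpsP => n; first by rewrite /= mulrDr.
rewrite fcoefD /= mulr_sumr -big_split /=; apply: eq_bigr => i _.
have -> : n%:R = i%:R + (n - i)%:R :> k by rewrite -natrD subnKC // -ltnS.
by ring.
Qed.

Lemma fps_der_const M c : fps_der M (fps_const c) = 0.
Proof. by apply: fpsP => -[|n]; rewrite fcoef0 /= ?mulr0 // mul0r mul0r. Qed.

Lemma fcoefCM c (a : L) n : fcoef (fps_const c * a) n = c * fcoef a n.
Proof.
rewrite fcoefM big_ord_recl subn0 /= big1 ?addr0 // => i _.
by rewrite mul0r.
Qed.

Lemma fcoefXn j n : fcoef (fps_var ^+ j) n = (n == j)%:R.
Proof.
rewrite -[fps_var ^+ j]mulr1 fcoefXnM fcoef1.
case: ltnP => [lt_nj|le_jn]; first by rewrite (ltn_eqF lt_nj).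
by rewrite subn_eq0 eqn_leq le_jn andbT.
Qed.

Lemma fps_der_var M j : fps_der M (fps_var ^+ j) = fps_const (j%:R / M%:R) * fps_var ^+ j.
Proof.
apply: fpsP => n; rewrite fcoefCM /= fcoefXn.
by case: eqP => [->|_] //; rewrite !mulr0.
Qed.

End PowerSeries.

(** * Formal leaves *)

Section Congruence.
Variable k : fieldType.
Local Notation L := (fps k).
Local Notation B := {poly {poly {poly k}}}.

Definition cong m (a b : L) := forall i, (i < m)%N -> fcoef a i = fcoef b i.

Lemma congD m a b c d : cong m a b -> cong m c d -> cong m (a + c) (b + d).
Proof. by move=> ab cd i lt; rewrite !fcoefD ab ?cd. Qed.

Lemma congN m a b : cong m a b -> cong m (- a) (- b).
Proof. by move=> ab i lt; rewrite !fcoefN ab. Qed.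

Lemma congM m a b c d : cong m a b -> cong m c d -> cong m (a * c) (b * d).
Proof.
move=> ab cd i lt; rewrite !fcoefM; apply: eq_bigr => l _.
by rewrite ab ?cd //; have := ltn_ord l; lia.
Qed.

(** A factor without constant term gains one order: the coefficient of index [m] involves only lower
    coefficients of the other factor. *)
Lemma congM_small m a b c d :
  cong m a b -> cong m.+1 c d -> fcoef c 0 = 0 -> cong m.+1 (c * a) (d * b).
Proof.
move=> ab cd c0 i lt; rewrite !fcoefM !big_ord_recl /= -(cd 0%N isT) c0 !mul0r.
congr (_ + _); apply: eq_bigr => l _; rewrite /bump /= add1n.
by rewrite cd ?ab //; have := ltn_ord l; lia.
Qed.

Lemma congXn m n a b : (0 < n)%N -> cong m a b ->
  cong m.+1 (fps_var k ^+ n * a) (fps_var k ^+ n * b).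
Proof. by move=> n0 ab i lt; rewrite !fcoefXnM; case: ltnP => // le; apply: ab; lia. Qed.

Lemma congW m a b : cong m.+1 a b -> cong m a b.
Proof. by move=> ab i lt; apply: ab; apply: ltnW. Qed.

Definition feval (x y w : L) : {rmorphism B -> L} := bev (@fps_const k) x y w.

Lemma cong_feval m x x' y y' w w' : cong m x x' -> cong m y y' -> cong m w w' ->
  forall p, cong m (feval x y w p) (feval x' y' w' p).
Proof.
move=> xx yy ww; have [ex ey ew ec] := bevE (@fps_const k) x y w.
have [ex' ey' ew' ec'] := bevE (@fps_const k) x' y' w'.
rewrite /feval; move: (bev _ _ _ _) (bev _ _ _ _) ex ey ew ec ex' ey' ew' ec' => f g.
move=> ex ey ew ec ex' ey' ew' ec'.
apply: B_ind => [p q cp cq|p q cp cq||||c]; rewrite ?ex ?ey ?ew ?ec ?ex' ?ey' ?ew' ?ec' //.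
  by rewrite !rmorphD; apply: congD.
by rewrite !rmorphM; apply: congM.
Qed.

Lemma fcoef_feval0 x y w p : fcoef x 0 = 0 -> fcoef y 0 = 0 ->
  fcoef (feval x y w p) 0 = (corner k p).[fcoef w 0].
Proof.
move=> x0 y0; have [ex ey ew ec] := bevE (@fps_const k) x y w.
have cx : corner k (@Bx k) = 0 by rewrite corner_const hornerX.
have cy : corner k (@By k) = 0 by rewrite /= /horner_eval hornerX horner0.
have cw : corner k (@Bw k) = 'X by rewrite corner_const hornerC.
have cc c : corner k (@Bconst k c) = c%:P by rewrite corner_const hornerC.
rewrite /feval; move: (bev _ _ _ _) (corner k) ex ey ew ec cx cy cw cc => f g.
move=> ex ey ew ec cx cy cw cc; move: p.
apply: B_ind => [p q cp cq|p q cp cq||||c].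
- by rewrite !rmorphD fcoefD hornerD cp cq.
- by rewrite !rmorphM fcoefM0 hornerM cp cq.
- by rewrite ex x0 cx horner0.
- by rewrite ey y0 cy horner0.
- by rewrite ew cw hornerX.
- by rewrite ec cc hornerC.
Qed.

Lemma corner_split (p : B) : corner k p = 0 -> exists p1 p2, p = @Bx k * p1 + @By k * p2.
Proof.
have split0 (A : comNzRingType) (q : {poly A}) : exists q1, q = q.[0]%:P + 'X * q1.
  elim/poly_ind: q => [|q c _]; first by exists 0; rewrite horner0 mulr0 addr0.
  by exists q; rewrite hornerD hornerM hornerX mulr0 add0r hornerC addrC mulrC.
move=> cp; have [p2 pE] := split0 _ p; have [p1 p1E] := split0 _ p.[0].
exists p1%:P, p2; rewrite {1}pE {1}p1E -[p.[0].[0]]/(corner k p) cp polyC0 add0r.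
by rewrite polyCM.
Qed.

(** Here [p] lies in the ideal generated by [x] and [y], whose values have no constant term, so [w]
    may be known to one order less. *)
Lemma cong_feval_small m x x' y y' w w' (p : B) :
  cong m.+1 x x' -> cong m.+1 y y' -> cong m w w' ->
  fcoef x 0 = 0 -> fcoef y 0 = 0 -> corner k p = 0 ->
  cong m.+1 (feval x y w p) (feval x' y' w' p).
Proof.
move=> xx yy ww x0 y0 /corner_split[p1 [p2 ->]].
have [ex ey _ _] := bevE (@fps_const k) x y w.
have [ex' ey' _ _] := bevE (@fps_const k) x' y' w'.
have c p' := cong_feval (congW xx) (congW yy) ww p'.
move: ex ey ex' ey' c; rewrite /feval; move: (bev _ _ _ _) (bev _ _ _ _) => f g ex ey ex' ey' c.
rewrite !rmorphD !rmorphM ex ey ex' ey'.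
by apply: congD; apply: congM_small.
Qed.

End Congruence.

(** * Existence and uniqueness of the formal leaves *)

Section Flow.
Variable k : fieldType.
Hypothesis char0 : [pchar k] =i pred0.
Local Notation L := (fps k).
Local Notation B := {poly {poly {poly k}}}.
Local Notation s := (fps_var k).

(** The cofactor of [x] minus its value [1 + w] at the corner; [excess_y] is the analogue for
    [1 - w]. *)
Definition excess_x : B := field_x (@Bx k) (@By k) (@Bw k) - (1 + @Bw k).
Definition excess_y : B := field_y (@Bx k) (@By k) (@Bw k) - (1 - @Bw k).
Definition Bfield_w : B := field_w (@Bx k) (@By k) (@Bw k).

Lemma corner_excess : [/\ corner k excess_x = 0, corner k excess_y = 0 & corner k Bfield_w = 0].
Proof.
have cx : corner k (@Bx k) = 0 by rewrite corner_const hornerX.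
have cy : corner k (@By k) = 0 by rewrite /= /horner_eval hornerX horner0.
have cw : corner k (@Bw k) = 'X by rewrite corner_const hornerC.
rewrite /excess_x /excess_y /Bfield_w.
have [hx hy hw] := rmorph_field (corner k) (@Bx k) (@By k) (@Bw k).
move: (corner k) (field_x _ _ _) (field_y _ _ _) (field_w _ _ _) cx cy cw hx hy hw.
move=> c fx fy fw cx cy cw hx hy hw.
rewrite !rmorphB rmorphD rmorph1 hx hy hw cx cy cw /field_x /field_y /field_w.
by split; ring.
Qed.

Lemma feval_excess x y w :
  [/\ field_x x y w = 1 + w + feval x y w excess_x,
      field_y x y w = 1 - w + feval x y w excess_y & field_w x y w = feval x y w Bfield_w].
Proof.
have [ex ey ew _] := bevE (@fps_const k) x y w.
rewrite /excess_x /excess_y /Bfield_w /feval; move: (bev _ _ _ _) ex ey ew => f ex ey ew.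
have [hx hy hw] := rmorph_field f (@Bx k) (@By k) (@Bw k).
move: (field_x (@Bx k) _ _) (field_y (@Bx k) _ _) (field_w (@Bx k) _ _) hx hy hw.
move=> fx fy fw hx hy hw.
rewrite !rmorphB rmorphD rmorph1 hx hy hw ex ey ew.
move: (field_x _ _ _) (field_y _ _ _) => gx gy.
by split; ring.
Qed.

Variable M : nat.
Hypothesis M0 : (0 < M)%N.
Local Notation D := (@fps_der k M).

Lemma M_neq0 : (M%:R : k) != 0.
Proof. by rewrite ((pcharf0P k).1 char0) -lt0n. Qed.

Definition fps_int (a : L) : L :=
  Fps (fun n => if n is n'.+1 then M%:R / n%:R * fcoef a n else 0).

Lemma fps_intK a : fcoef a 0 = 0 -> D (fps_int a) = a.
Proof.
move=> a0; apply: fpsP => -[|n] /=; first by rewrite mulr0 a0.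
have n0 : (n.+1%:R : k) != 0 by rewrite ((pcharf0P k).1 char0).
move: (M%:R : k) (n.+1%:R : k) M_neq0 n0 => u v u0 v0.
by field; rewrite u0 v0.
Qed.

Lemma cong_int m a b : cong m a b -> cong m (fps_int a) (fps_int b).
Proof. by move=> ab [|i] lt //=; rewrite ab. Qed.

Lemma cong_der m a b : fcoef a 0 = fcoef b 0 -> cong m (D a) (D b) -> cong m a b.
Proof.
move=> ab0 ab [|i] lt //; have /= := ab _ lt; apply: mulfI.
by rewrite mulf_neq0 ?invr_eq0 ?M_neq0 // ((pcharf0P k).1 char0).
Qed.

(** This value of [w] is forced: [s ^ j] has eigenvalue [j / M], which must equal [1 + w] at the
    corner. The exponent [2 M - j] of [y] then matches [1 - w]. *)
Definition flow_start j : k := j%:R / M%:R - 1.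

(* For [q = s^(2M)] the derivation [fps_der M] is [2 q d/dq], and [flow j] is the
   formal leaf with [x ~ - q^b] and [y ~ - q^(1 - b)] where [b = j / 2M]. *)
Definition flow j (x y w : L) :=
  (exists xi eta, [/\ x = - s ^+ j * xi, y = - s ^+ (2 * M - j) * eta,
     fcoef xi 0 = 1, fcoef eta 0 = 1 & fcoef w 0 = flow_start j]) /\
  [/\ D x = x * field_x x y w, D y = y * field_y x y w & D w = field_w x y w].

Lemma complement_ratio j : (j <= 2 * M)%N ->
  (2 * M - j)%:R / M%:R = 1 - flow_start j :> k.
Proof.
move=> le; rewrite /flow_start natrB // natrM.
by field; rewrite M_neq0.
Qed.

Lemma flow_axis j (xi w f : L) : fcoef xi 0 = 1 -> (0 < j)%N ->
  D (- s ^+ j * xi) = - s ^+ j * xi * (fps_const (j%:R / M%:R) + f) <-> D xi = xi * f.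
Proof.
move=> xi0 j0; have dd := @fps_derP k M.
rewrite dd.2 (derN dd) fps_der_var; split => [e|->]; last by ring.
apply: (mulfI (fps_var_exp_neq0 k j)); apply: oppr_inj.
apply: (addrI (- (fps_const (j%:R / M%:R) * s ^+ j) * xi)).
transitivity (- (fps_const (j%:R / M%:R) * s ^+ j) * xi + - s ^+ j * D xi); first by ring.
by rewrite e; ring.
Qed.

(** Dividing [x] and [y] by their leading powers and subtracting the initial value from [w] leaves a
    system whose right sides have no constant term, so it can be integrated and solved as a causal
    fixed point. *)
Lemma flow_exists j : (0 < j)%N -> (j < 2 * M)%N -> exists x y w, flow j x y w.
Proof.
move=> j0 jM; pose j' := (2 * M - j)%N; have j'0 : (0 < j')%N by rewrite subn_gt0.
pose w0 := flow_start j.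
pose S1 (f : nat -> k * k * k) := Fps (fun n => (f n).1.1).
pose S2 (f : nat -> k * k * k) := Fps (fun n => (f n).1.2).
pose S3 (f : nat -> k * k * k) := Fps (fun n => (f n).2).
pose X f := - s ^+ j * S1 f; pose Y f := - s ^+ j' * S2 f.
pose W f := fps_const w0 + S3 f.
pose E f p := feval (X f) (Y f) (W f) p.
pose O f := fps_int (E f Bfield_w).
(* At the fixed point [O f] equals the third component [S3 f]; it is used in its place because it is
   determined to one order more. *)
pose U f := O f + E f excess_x; pose V f := - O f + E f excess_y.
pose P f := 1 + fps_int (U f * S1 f); pose Q f := 1 + fps_int (V f * S2 f).
have X0 f : fcoef (X f) 0 = 0 by rewrite /X mulNr fcoefN fcoefXnM j0 oppr0.
have Y0 f : fcoef (Y f) 0 = 0 by rewrite /Y mulNr fcoefN fcoefXnM j'0 oppr0.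
have [cx cy cw] := corner_excess.
have E0 f p : corner k p = 0 -> fcoef (E f p) 0 = 0.
  by move=> cp; rewrite /E fcoef_feval0 ?cp ?horner0.
have U0 f : fcoef (U f) 0 = 0 by rewrite /U fcoefD E0 // add0r.
have V0 f : fcoef (V f) 0 = 0 by rewrite /V fcoefD fcoefN E0 // oppr0 add0r.
have [|f fE] := @causal_fixpoint (k * k * k) (0, 0, 0)
    (fun f n => (fcoef (P f) n, fcoef (Q f) n, fcoef (O f) n)).
  move=> m f g fg.
  have c1 : cong m (S1 f) (S1 g) by move=> i lt; rewrite /= fg.
  have c2 : cong m (S2 f) (S2 g) by move=> i lt; rewrite /= fg.
  have c3 : cong m (S3 f) (S3 g) by move=> i lt; rewrite /= fg.
  have cX : cong m.+1 (X f) (X g) by rewrite /X !mulNr; apply: congN; apply: congXn.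
  have cY : cong m.+1 (Y f) (Y g) by rewrite /Y !mulNr; apply: congN; apply: congXn.
  have cW : cong m (W f) (W g) by apply: congD.
  have cE p : corner k p = 0 -> cong m.+1 (E f p) (E g p).
    by move=> cp; apply: cong_feval_small.
  have cO : cong m.+1 (O f) (O g) by apply: cong_int; apply: cE.
  have cU : cong m.+1 (U f) (U g) by apply: congD => //; apply: cE.
  have cV : cong m.+1 (V f) (V g) by apply: congD; [apply: congN | apply: cE].
  have cP : cong m.+1 (P f) (P g).
    by apply: congD => //; apply: cong_int; apply: congM_small.
  have cQ : cong m.+1 (Q f) (Q g).
    by apply: congD => //; apply: cong_int; apply: congM_small.
  by move=> i le_im; rewrite cP ?cQ ?cO.
have e1 : S1 f = P f by apply: fpsP => n; rewrite /= fE.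
have e2 : S2 f = Q f by apply: fpsP => n; rewrite /= fE.
have e3 : S3 f = O f by apply: fpsP => n; rewrite /= fE.
have dd := @fps_derP k M.
have d3 : D (S3 f) = E f Bfield_w by rewrite e3 fps_intK // E0.
have d1 : D (S1 f) = S1 f * (S3 f + E f excess_x).
  rewrite {1}e1 dd.1 (der1 dd) add0r fps_intK; first by rewrite /U e3 mulrC.
  by rewrite fcoefM0 U0 mul0r.
have d2 : D (S2 f) = S2 f * (- S3 f + E f excess_y).
  rewrite {1}e2 dd.1 (der1 dd) add0r fps_intK; first by rewrite /V e3 mulrC.
  by rewrite fcoefM0 V0 mul0r.
have s1 : fcoef (S1 f) 0 = 1 by rewrite e1 fcoefD addr0 fcoef1.
have s2 : fcoef (S2 f) 0 = 1 by rewrite e2 fcoefD addr0 fcoef1.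
have s3 : fcoef (S3 f) 0 = 0 by rewrite e3.
exists (X f), (Y f), (W f); split.
  by exists (S1 f), (S2 f); split=> //; rewrite /W fcoefD s3 addr0.
have [-> -> ->] := feval_excess (X f) (Y f) (W f); split.
- have /(flow_axis 0 _ s1 j0) := d1; rewrite -/(X f) => ->; congr (_ * _).
  have -> : j%:R / M%:R = 1 + w0 by rewrite /w0 /flow_start addrC subrK.
  by rewrite rmorphD rmorph1 /W /E; ring.
- have /(flow_axis 0 _ s2 j'0) := d2; rewrite -/(Y f) => ->; congr (_ * _).
  have -> : j'%:R / M%:R = 1 - w0 by rewrite complement_ratio // ltnW.
  by rewrite rmorphB rmorph1 /W /E; ring.
- by rewrite /W dd.1 fps_der_const add0r d3.
Qed.

(** Agreement to order [m] improves to [m.+1]: first for [x] and [y], which carry positive powers of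
    [s], then for [w], and finally for the unit factors. *)
Lemma flow_unique j x y w x' y' w' : (0 < j)%N -> (j < 2 * M)%N ->
  flow j x y w -> flow j x' y' w' -> [/\ x = x', y = y' & w = w'].
Proof.
move=> j0 jM; pose j' := (2 * M - j)%N; have j'0 : (0 < j')%N by rewrite subn_gt0.
have reduced X Y W : flow j X Y W -> exists xi eta,
    [/\ X = - s ^+ j * xi, Y = - s ^+ j' * eta & [/\ fcoef xi 0 = 1, fcoef eta 0 = 1,
      D xi = xi * (W - fps_const (flow_start j) + feval X Y W excess_x),
      D eta = eta * (- (W - fps_const (flow_start j)) + feval X Y W excess_y)
      & D W = feval X Y W Bfield_w]].
  case=> -[xi [eta [XE YE xi0 eta0 _]]]; have [-> -> ->] := feval_excess X Y W.
  case=> DX DY DW; exists xi, eta; split=> //; split=> //.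
    apply/(flow_axis 0 _ xi0 j0); rewrite -XE DX; congr (_ * _).
    have -> : j%:R / M%:R = 1 + flow_start j by rewrite /flow_start addrC subrK.
    by rewrite (rmorphD (@fps_const k)) (rmorph1 (@fps_const k)); ring.
  apply/(flow_axis 0 _ eta0 j'0); rewrite -YE DY; congr (_ * _).
  have -> : j'%:R / M%:R = 1 - flow_start j by rewrite complement_ratio // ltnW.
  by rewrite (rmorphB (@fps_const k)) (rmorph1 (@fps_const k)); ring.
move=> F F'; have w0 : fcoef w 0 = flow_start j by case: F => -[? [? []]].
have w0' : fcoef w' 0 = flow_start j by case: F' => -[? [? []]].
have [xi [eta [xE yE [xi0 eta0 dxi deta dw]]]] := reduced _ _ _ F.
have [xi' [eta' [xE' yE' [xi0' eta0' dxi' deta' dw']]]] := reduced _ _ _ F'.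
have x0 : fcoef x 0 = 0 by rewrite xE mulNr fcoefN fcoefXnM j0 oppr0.
have y0 : fcoef y 0 = 0 by rewrite yE mulNr fcoefN fcoefXnM j'0 oppr0.
have [cx cy cw] := corner_excess.
have H m : [/\ cong m xi xi', cong m eta eta' & cong m w w'].
  elim: m => [|m [c1 c2 c3]]; first by split.
  have cX : cong m.+1 x x' by rewrite xE xE' !mulNr; apply: congN; apply: congXn.
  have cY : cong m.+1 y y' by rewrite yE yE' !mulNr; apply: congN; apply: congXn.
  have cE p : corner k p = 0 -> cong m.+1 (feval x y w p) (feval x' y' w' p).
    by move=> cp; apply: cong_feval_small.
  have c3' : cong m.+1 w w'.
    by apply: cong_der; [rewrite w0 w0' | rewrite dw dw'; apply: cE].
  have z : fcoef (w - fps_const (flow_start j)) 0 = 0 by rewrite fcoefD fcoefN w0 subrr.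
  have ez p : corner k p = 0 -> fcoef (feval x y w p) 0 = 0.
    by move=> cp; rewrite fcoef_feval0 // cp horner0.
  have c3'' : cong m.+1 (w - fps_const (flow_start j)) (w' - fps_const (flow_start j)).
    exact: congD.
  split=> //; apply: cong_der; rewrite ?xi0 ?eta0 //.
    rewrite dxi dxi' mulrC [xi' * _]mulrC; apply: congM_small => //.
      by apply: congD => //; apply: cE.
    by rewrite fcoefD z ez // addr0.
  rewrite deta deta' mulrC [eta' * _]mulrC; apply: congM_small => //.
    by apply: congD; [apply: congN | apply: cE].
  by rewrite fcoefD fcoefN z ez // oppr0 addr0.
rewrite xE yE xE' yE'; have -> : xi' = xi by apply: fpsP => n; have [c _ _] := H n.+1; rewrite c.
have -> : eta' = eta by apply: fpsP => n; have [_ c _] := H n.+1; rewrite c.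
by split=> //; apply: fpsP => n; have [_ _ c] := H n.+1; rewrite c.
Qed.

End Flow.

(** * Doubling of solutions in a domain *)

Section DoubledPoint.

(* The image of [(x, y, w)] under multiplication by [-2], which on the plane cubic
   is given by the tangent line, followed by the exchange of [x] and [z]. *)
Definition doubled (R : comNzRingType) (x y w X Y W : R) :=
  let z := 1 - x - y in
  [/\ X * ((z - x) * (y - z)) = z * (x - y) ^+ 2,
      Y * ((y - z) * (x - y)) = y * (z - x) ^+ 2
    & (W - 2%:R * w) * ((x - y) * (y - z) * (z - x)) = dbl_num x y z].

(* The doubling relations differentiated along a tangent vector. *)
Definition doubled_tangent (R : comNzRingType) (x y w X Y W dx dy dw dX dY dW : R) :=
  let z := 1 - x - y in let dz := - dx - dy in
  let e2 := x * y + y * z + z * x in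
  let de2 := dx * (y + z) + dy * (x + z) + dz * (x + y) in
  [/\ dX * ((z - x) * (y - z)) + X * ((dz - dx) * (y - z) + (z - x) * (dy - dz)) =
      dz * (x - y) ^+ 2 + 2%:R * z * (x - y) * (dx - dy),
      dY * ((y - z) * (x - y)) + Y * ((dy - dz) * (x - y) + (y - z) * (dx - dy)) =
      dy * (z - x) ^+ 2 + 2%:R * y * (z - x) * (dz - dx)
    & (dW - 2%:R * dw) * ((x - y) * (y - z) * (z - x)) + (W - 2%:R * w) *
      ((dx - dy) * (y - z) * (z - x) + (x - y) * ((dy - dz) * (z - x) + (y - z) * (dz - dx))) =
      12%:R * e2 * de2 - de2 - 9%:R * (dx * y * z + x * dy * z + x * y * dz)].

Lemma doubled_der (A : comNzRingType) (D : A -> A) (x y w X Y W : A) :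
  derivation D -> doubled x y w X Y W ->
  doubled_tangent x y w X Y W (D x) (D y) (D w) (D X) (D Y) (D W).
Proof.
move=> dD; rewrite /doubled /doubled_tangent /=; set z := 1 - x - y.
have Dz : D z = - D x - D y by rewrite /z !(derB dD) (der1 dD) sub0r.
clearbody z => -[eX eY eW]; rewrite -Dz; split.
- move/(congr1 D): eX; rewrite expr2 !dD.2 !(derB dD) => e.
  transitivity (D z * ((x - y) * (x - y)) + z * ((D x - D y) * (x - y) + (x - y) * (D x - D y)));
    last by ring.
  by rewrite -e; ring.
- move/(congr1 D): eY; rewrite expr2 !dD.2 !(derB dD) => e.
  transitivity (D y * ((z - x) * (z - x)) + y * ((D z - D x) * (z - x) + (z - x) * (D z - D x)));
    last by ring.
  by rewrite -e; ring.
(* The numerals become named constants of derivative zero, so that the product rule can be rewritten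
   through them. *)
- have nat_const n : exists2 c : A, c = n%:R & D c = 0 by exists n%:R; rewrite ?der_nat.
  have [c2 E2 D2] := nat_const 2%N; have [c6 E6 D6] := nat_const 6%N.
  have [c9 E9 D9] := nat_const 9%N.
  move: eW; rewrite /dbl_num -{1}E2 -E6 -E9 => /(congr1 D).
  rewrite !(dD.2, dD.1, derB dD, derN dD) D2 D6 D9 E2 E6 E9 => e.
  set lhs := LHS; set rhs := RHS; move: e; set l := LHS; set r := RHS => e.
  have -> : lhs = l by rewrite /lhs /l; ring.
  have -> : rhs = r by rewrite /rhs /r; ring.
  exact: e.
Qed.

Lemma doubled_tangent_field (F : fieldType) (x y w X Y W dX dY dW : F) (z := 1 - x - y) :
  x - y != 0 -> y - z != 0 -> z - x != 0 -> doubled x y w X Y W ->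
  doubled_tangent x y w X Y W (x * field_x x y w) (y * field_y x y w) (field_w x y w)
    dX dY dW ->
  [/\ dX = X * field_x X Y W, dY = Y * field_y X Y W & dW = field_w X Y W].
Proof.
move=> xy yz zx [eX eY eW] [tX tY tW].
have nX : (z - x) * (y - z) != 0 by rewrite mulf_neq0.
have nY : (y - z) * (x - y) != 0 by rewrite mulf_neq0.
have nW : (x - y) * (y - z) * (z - x) != 0 by rewrite !mulf_neq0.
have XE := canRL (mulfK nX) eX; have YE := canRL (mulfK nY) eY.
have WE : W = 2%:R * w + dbl_num x y z / ((x - y) * (y - z) * (z - x)).
  by rewrite addrC -(canRL (mulfK nW) eW) subrK.
rewrite XE in tX; rewrite YE in tY; rewrite WE in tW; rewrite XE YE WE.
split; first exact: doubling_field_x tX.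
  exact: doubling_field_y tY.
exact: doubling_field_w tW.
Qed.

(** The relations and their derivatives are carried to the fraction field, where the field
    identities apply, and the result descends by injectivity. The derivation itself is not
    extended. *)
Lemma doubled_flow (A : idomainType) (D : A -> A) (x y w X Y W : A) (z := 1 - x - y) :
  derivation D -> x - y != 0 -> y - z != 0 -> z - x != 0 -> doubled x y w X Y W ->
  D x = x * field_x x y w -> D y = y * field_y x y w -> D w = field_w x y w ->
  [/\ D X = X * field_x X Y W, D Y = Y * field_y X Y W & D W = field_w X Y W].
Proof.
move=> dD xy yz zx dbl Dx Dy Dw.
have [T [inj T0]] : exists T : {rmorphism A -> {fraction A}},
    injective T /\ forall a, a != 0 -> T a != 0.
  exists (@tofrac A); split=> [a b /eqP|a]; last by rewrite tofrac_eq0.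
  by rewrite tofrac_eq => /eqP.
have [fx fy fw] := rmorph_field T x y w; have [gx gy gw] := rmorph_field T X Y W.
have Tz : T z = 1 - T x - T y by rewrite /z !(rmorphB T) (rmorph1 T).
have := doubled_der dD dbl; rewrite Dx Dy Dw.
move: dbl (D X) (D Y) (D W) => dbl dX dY dW tan.
suff [eX eY eW] : [/\ T dX = T X * field_x (T X) (T Y) (T W),
    T dY = T Y * field_y (T X) (T Y) (T W) & T dW = field_w (T X) (T Y) (T W)].
  by split; apply: inj; rewrite ?(rmorphM T) ?gx ?gy ?gw.
apply: (@doubled_tangent_field _ (T x) (T y) (T w)).
- by rewrite -(rmorphB T) T0.
- by rewrite -Tz -(rmorphB T) T0.
- by rewrite -Tz -(rmorphB T) T0.
- case: dbl => [/(congr1 T) e1 /(congr1 T) e2 /(congr1 T) e3]; move: e1 e2 e3.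
  rewrite /doubled /= -Tz -/z /dbl_num => e1 e2 e3.
  move: e1 e2 e3; rewrite !(rmorphD T, rmorphM T, rmorphN T, rmorphXn T, rmorph_nat T, rmorph1 T).
  by move=> e1 e2 e3; split.
- rewrite -fx -fy -fw -!(rmorphM T).
  move: (x * field_x x y w) (y * field_y x y w) (field_w x y w) tan => dx dy dw.
  case=> [/(congr1 T) e1 /(congr1 T) e2 /(congr1 T) e3]; move: e1 e2 e3.
  rewrite /doubled_tangent /= -Tz -/z.
  rewrite !(rmorphD T, rmorphM T, rmorphN T, rmorphXn T, rmorph_nat T, rmorph1 T).
  by move=> e1 e2 e3; split.
Qed.

End DoubledPoint.

(** * Algebraicity and density of the torsion leaves *)

Section Leaves.
Variable k : fieldType.
Hypothesis char0 : [pchar k] =i pred0.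
Local Notation L := (fps k).
Local Notation B := {poly {poly {poly k}}}.
Local Notation s := (fps_var k).

Lemma fps_inverse (a : L) : fcoef a 0 != 0 ->
  exists b, b * a = 1 /\ fcoef b 0 * fcoef a 0 = 1.
Proof.
move=> /fps_inv_exists[b ba]; exists b; split=> //.
by rewrite -fcoefM0 ba fcoef1.
Qed.

Lemma fcoefXn0 n : (0 < n)%N -> fcoef (s ^+ n) 0 = 0.
Proof. by case: n => // n _; rewrite fcoefXn. Qed.

Lemma fcoef0_neq0 (a : L) : fcoef a 0 != 0 -> a != 0.
Proof. by apply: contra_neq => ->; rewrite fcoef0. Qed.

Section OneFlow.
Variables (M j : nat) (x y w : L).
Hypotheses (j0 : (0 < j)%N) (jM : (j < M)%N) (fl : flow M j x y w).
Let z := 1 - x - y.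

(** As [j < M], the order of [y] exceeds the order [j] of [x], so [x - y] has order [j]; and [z] has
    constant term 1. *)
Lemma flow_denominators : [/\ x - y != 0, y - z != 0 & z - x != 0].
Proof.
have [[xi [eta [xE yE xi0 eta0 _]]] _] := fl.
have x0 : fcoef x 0 = 0 by rewrite xE mulNr fcoefN fcoefM0 fcoefXn0 // mul0r oppr0.
have y0 : fcoef y 0 = 0.
  by rewrite yE mulNr fcoefN fcoefM0 fcoefXn0 ?mul0r ?oppr0 // subn_gt0; lia.
have z0 : fcoef z 0 = 1 by rewrite /z !fcoefD !fcoefN x0 y0 !subr0 fcoef1.
split; last 2 first.
- by apply: fcoef0_neq0; rewrite fcoefD fcoefN y0 z0 sub0r oppr_eq0 oner_neq0.
- by apply: fcoef0_neq0; rewrite fcoefD fcoefN x0 z0 subr0 oner_neq0.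
have -> : x - y = s ^+ j * - (xi - s ^+ (2 * (M - j)) * eta).
  rewrite xE yE; have -> : (2 * M - j = j + 2 * (M - j))%N by lia.
  by rewrite exprD; ring.
rewrite mulf_neq0 ?fps_var_exp_neq0 // oppr_eq0; apply: fcoef0_neq0.
rewrite fcoefD fcoefN fcoefM0 fcoefXn0 ?mul0r ?subr0 ?xi0 ?oner_neq0 //.
by rewrite muln_gt0 subn_gt0.
Qed.

(** The orders become [2 j] for [X] and [(2 M - j) - j] for [Y], and the constant term of [W] is
    [2 (j / M - 1) + 1], the initial value for [2 j]. *)
Lemma flow_double : exists X Y W, flow M (2 * j) X Y W /\ doubled x y w X Y W.
Proof.
have M0 : (0 < M)%N by apply: leq_ltn_trans jM.
have [[xi [eta [xE yE xi0 eta0 w0]]] [Dx Dy Dw]] := fl.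
have x0 : fcoef x 0 = 0 by rewrite xE mulNr fcoefN fcoefM0 fcoefXn0 // mul0r oppr0.
have y0 : fcoef y 0 = 0.
  by rewrite yE mulNr fcoefN fcoefM0 fcoefXn0 ?mul0r ?oppr0 // subn_gt0; lia.
have z0 : fcoef z 0 = 1 by rewrite /z !fcoefD !fcoefN x0 y0 !subr0 fcoef1.
have [nxy nyz nzx] := flow_denominators.
pose t := s ^+ (2 * (M - j)).
have t0 : fcoef t 0 = 0 by rewrite fcoefXn0 // muln_gt0 subn_gt0.
have {}yE : y = - s ^+ j * (t * eta).
  rewrite yE; have -> : (2 * M - j = j + 2 * (M - j))%N by lia.
  by rewrite exprD -/t; ring.
have ta0 : fcoef (t * eta) 0 = 0 by rewrite fcoefM0 t0 mul0r.
pose kap := xi - t * eta.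
have kap0 : fcoef kap 0 = 1 by rewrite fcoefD fcoefN ta0 subr0.
have [K [KE K0]] : exists b, b * kap = 1 /\ fcoef b 0 * fcoef kap 0 = 1.
  by apply: fps_inverse; rewrite kap0 oner_neq0.
have [U [UE U0]] : exists b, b * (z - x) = 1 /\ fcoef b 0 * fcoef (z - x) 0 = 1.
  by apply: fps_inverse; rewrite fcoefD fcoefN x0 z0 subr0 oner_neq0.
have [V [VE V0]] : exists b, b * (y - z) = 1 /\ fcoef b 0 * fcoef (y - z) 0 = 1.
  by apply: fps_inverse; rewrite fcoefD fcoefN y0 z0 sub0r oppr_eq0 oner_neq0.
rewrite kap0 mulr1 in K0; rewrite fcoefD fcoefN x0 z0 subr0 mulr1 in U0.
rewrite fcoefD fcoefN y0 z0 sub0r mulrN1 in V0.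
pose e2 := x * y + y * z + z * x.
(* The splitting [dbl_num x y z = n1 * x + n2 * y] exhibits the factor [s ^ j] that cancels against
   [x - y]. *)
pose n1 := 6%:R * (y + z) * e2 - (y + z) - 9%:R * y * z.
pose n2 := 6%:R * z * e2 - z.
pose Xi := - (z * kap ^+ 2 * (U * V)); pose X := - s ^+ (2 * j) * Xi.
pose Et := - (eta * (z - x) ^+ 2 * (V * K)); pose Y := - t * Et.
pose W := 2%:R * w + (n1 * (xi * K) + n2 * (t * eta * K)) * (U * V).
have xyE : x - y = - s ^+ j * kap by rewrite xE yE /kap; ring.
have dbl : doubled x y w X Y W.
  rewrite /doubled -/z; split.
  - rewrite /X /Xi xyE mulnC exprM.
    transitivity (s ^+ j ^+ 2 * (z * kap ^+ 2) * (U * (z - x)) * (V * (y - z))); first by ring.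
    by rewrite UE VE; ring.
  - rewrite /Y /Et xyE yE.
    transitivity (- s ^+ j * (t * eta) * (z - x) ^+ 2 * (V * (y - z)) * (K * kap)).
      by rewrite yE; ring.
    by rewrite KE VE; ring.
  - rewrite /W xyE.
    transitivity ((n1 * (- s ^+ j * xi) + n2 * (- s ^+ j * (t * eta))) *
      (U * (z - x)) * (V * (y - z)) * (K * kap)); first by ring.
    by rewrite KE UE VE -xE -yE /n1 /n2 /dbl_num -/e2 /e2; ring.
exists X, Y, W; split=> //; split.
  exists Xi, Et; split=> //.
  - by rewrite /Y /t; congr (- s ^+ _ * _); lia.
  - rewrite /Xi expr2 fcoefN !fcoefM0 kap0 z0 U0 !mul1r.
    exact: V0.
  - rewrite /Et expr2 fcoefN !fcoefM0 eta0 K0 fcoefD fcoefN z0 x0 subr0 !mul1r mulr1.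
    exact: V0.
  - have n10 : fcoef n1 0 = -1.
      have e20 : fcoef e2 0 = 0 by rewrite /e2 !fcoefD !fcoefM0 x0 y0; ring.
      have yz0 : fcoef (y + z) 0 = 1 by rewrite fcoefD y0 z0 add0r.
      by rewrite /n1 !fcoefD !fcoefN !fcoefM0 e20 y0 z0 yz0; ring.
    have [V1 c2] : fcoef V 0 = -1 /\ fcoef (2%:R : L) 0 = 2%:R.
      split; first by rewrite -V0 opprK.
      by rewrite -(rmorph_nat (@fps_const k) 2).
    rewrite /W fcoefD !fcoefM0 c2 fcoefD !fcoefM0 t0 n10 xi0 K0 U0 V1 w0 /flow_start natrM.
    by ring.
have [DX DY DW] := doubled_flow (@fps_derP k M) nxy nyz nzx dbl Dx Dy Dw.
by split.
Qed.

End OneFlow.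

Lemma flow_middle M (x y w : L) : (0 < M)%N -> flow M M x y w -> x = y.
Proof.
move=> M0 fl; have fl' : flow M M y x (- w).
  have M1 : (M%:R : k) != 0 by apply: M_neq0.
  have [[xi [eta [xE yE xi0 eta0 w0]]] [Dx Dy Dw]] := fl.
  have MM : (2 * M - M = M)%N by lia.
  split; first exists eta, xi; first split=> //.
  - by rewrite yE MM.
  - by rewrite xE MM.
  - by rewrite fcoefN w0 /flow_start divff // subrr oppr0.
  have [sx sy sw] := field_swap x y w; rewrite sx sy sw; split=> //.
  by rewrite (derN (@fps_derP k M)) Dw.
have M2 : (M < 2 * M)%N by lia.
by have [] := flow_unique char0 M0 M0 M2 fl fl'.
Qed.

(* Along the leaves near the edge the lexicographically lowest term dominates. *)
Lemma flow_generic (G : B) j : G != 0 -> (0 < j)%N ->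
  exists N, forall M (x y w : L), (N <= M)%N -> flow M j x y w -> feval x y w G != 0.
Proof.
move=> G0 j0; have [a [G1 [i [g [GE G1E g0]]]]] := corner_order G0.
(* The constant terms of [w] for different [M] are distinct, so the lowest coefficient [g.[0]]
   vanishes at only finitely many of them. *)
pose u M : k := j%:R / M%:R - 1.
have uI : injective u.
  have j1 : (j%:R : k) != 0 by rewrite ((pcharf0P k).1 char0) -lt0n.
  by move=> m n /(addIr (-1))/(mulfI j1)/invr_inj/(natr_inj char0).
have [N HN] := eventually_nonroot uI g0.
(* The second bound gives [j * i < 2 * M - j], so terms divisible by [y] do not reach the index
   [j * i]. *)
exists (maxn N (i.+1 * j).+1) => M x y w; rewrite geq_max => /andP[NM jM].
case=> -[xi [eta [xE yE xi0 eta0 w0]]] _.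
have x0 : fcoef x 0 = 0 by rewrite xE mulNr fcoefN fcoefM0 fcoefXn0 // mul0r oppr0.
have y0 : fcoef y 0 = 0.
  by rewrite yE mulNr fcoefN fcoefM0 fcoefXn0 ?mul0r ?oppr0 // subn_gt0; lia.
have [ex ey _ _] := bevE (@fps_const k) x y w.
have [G2 G1E'] : exists G2, G1 = @Bx k ^+ i * g%:P + @By k * G2.
  have [q] : exists q, G1 - (G1.[0])%:P = q * ('X - 0%:P).
    by apply/factor_theorem; rewrite rootE hornerD hornerN hornerC subrr.
  rewrite polyC0 subr0 => qE; exists q; rewrite [_ * q]mulrC -[By k]/'X -qE G1E.
  by rewrite polyCM polyC_exp addrC subrK.
have gg := fcoef_feval0 w g%:P x0 y0.
rewrite GE {1}G1E'.
move: ex ey gg; rewrite -/(feval x y w); move: (feval x y w) => f ex ey gg.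
rewrite -[('X : B)]/(By k) (rmorphM f) (rmorphXn f) (rmorphD f) !(rmorphM f) (rmorphXn f) ex ey.
have y1 : y != 0.
  rewrite yE mulf_neq0 ?oppr_eq0 ?fps_var_exp_neq0 //; apply: fcoef0_neq0.
  by rewrite eta0 oner_neq0.
rewrite mulf_neq0 ?expf_neq0 //; apply/eqP => /(congr1 (fun c : L => fcoef c (j * i))).
rewrite fcoef0 fcoefD yE !mulNr fcoefN -mulrA fcoefXnM.
have -> : (j * i < 2 * M - j)%N by lia.
rewrite oppr0 addr0 xE exprMn exprNn -exprM -!mulrA [_ * (s ^+ _ * _)]mulrCA.
rewrite fcoefXnM ltnn subnn !fcoefM0 gg w0 corner_const => /eqP.
have e0 (b : L) n : fcoef b 0 != 0 -> fcoef (b ^+ n) 0 != 0.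
  by move=> b0; elim: n => [|n IHn]; rewrite ?expr0 ?fcoef1 ?oner_neq0 // exprS fcoefM0 mulf_neq0.
rewrite !mulf_eq0 (negbTE (e0 _ _ _)) ?fcoefN ?fcoef1 ?oppr_eq0 ?oner_neq0 //=.
by rewrite (negbTE (e0 _ _ _)) ?xi0 ?oner_neq0 //= (negbTE (HN _ NM)).
Qed.

(** Pullback under doubling with denominators cleared. As [G'] is the same for all points, its
    vanishing on one leaf and its being nonzero can be tested on different leaves. *)
Lemma doubled_clear (G : B) : exists n G', forall x y w X Y W : L,
  doubled x y w X Y W -> feval x y w G' =
    ((x - y) * (y - (1 - x - y)) * (1 - x - y - x)) ^+ n * feval X Y W G.
Proof.
pose z : B := 1 - @Bx k - @By k.
have ev x y w : [/\ feval x y w (@Bx k) = x, feval x y w (@By k) = y, feval x y w (@Bw k) = w,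
    forall c, feval x y w (@Bconst k c) = fps_const c & feval x y w z = 1 - x - y].
  have [ex ey ew ec] := bevE (@fps_const k) x y w; split=> //.
  rewrite /z /feval; move: (bev _ _ _ _) ex ey => f ex ey.
  by rewrite !(rmorphB f) (rmorph1 f) ex ey.
clearbody z; pose den := (@Bx k - @By k) * (@By k - z) * (z - @Bx k).
have evd x y w : feval x y w den = (x - y) * (y - (1 - x - y)) * (1 - x - y - x).
  have [ex ey _ _ ez] := ev x y w; rewrite /den; move: (feval x y w) ex ey ez => f ex ey ez.
  by rewrite !(rmorphM f) !(rmorphB f) ex ey ez.
move: G; apply: B_ind => [p q [n [p' pE]] [m [q' qE]]|p q [n [p' pE]] [m [q' qE]]||||c].
- exists (n + m)%N, (p' * den ^+ m + q' * den ^+ n) => x y w X Y W dbl.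
  have := pE _ _ _ _ _ _ dbl; have := qE _ _ _ _ _ _ dbl; have := evd x y w.
  move: (feval x y w) (feval X Y W) => f g fd fq fp.
  rewrite (rmorphD f) !(rmorphM f) !(rmorphXn f) (rmorphD g) fp fq fd exprD.
  by ring.
- exists (n + m)%N, (p' * q') => x y w X Y W dbl.
  have := pE _ _ _ _ _ _ dbl; have := qE _ _ _ _ _ _ dbl.
  move: (feval x y w) (feval X Y W) => f g fq fp.
  by rewrite (rmorphM f) (rmorphM g) fp fq exprD; ring.
- exists 1%N, (z * (@Bx k - @By k) ^+ 3) => x y w X Y W [eX _ _].
  have [ex ey _ _ ez] := ev x y w; have [-> _ _ _ _] := ev X Y W.
  move: (feval x y w) ex ey ez => f ex ey ez.
  rewrite (rmorphM f) (rmorphXn f) (rmorphB f) ex ey ez expr1.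
  transitivity ((1 - x - y) * (x - y) ^+ 2 * (x - y)); first by ring.
  by rewrite -eX; ring.
- exists 1%N, (@By k * (z - @Bx k) ^+ 3) => x y w X Y W [_ eY _].
  have [ex ey _ _ ez] := ev x y w; have [_ -> _ _ _] := ev X Y W.
  move: (feval x y w) ex ey ez => f ex ey ez.
  rewrite (rmorphM f) (rmorphXn f) (rmorphB f) ex ey ez expr1.
  transitivity (y * (1 - x - y - x) ^+ 2 * (1 - x - y - x)); first by ring.
  by rewrite -eY; ring.
- exists 1%N, (2%:R * @Bw k * den + dbl_num (@Bx k) (@By k) z) => x y w X Y W [_ _ eW].
  have [ex ey ew _ ez] := ev x y w; have [_ _ -> _ _] := ev X Y W; have fd := evd x y w.
  move: (feval x y w) ex ey ez ew fd => f ex ey ez ew fd.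
  have -> : f (2%:R * @Bw k * den + dbl_num (@Bx k) (@By k) z) =
      2%:R * w * f den + dbl_num x y (1 - x - y).
    by rewrite -ez -ex -ey -ew /dbl_num; ring.
  rewrite fd expr1 -eW; ring.
- exists 0%N, (Bconst k c) => x y w X Y W _.
  have [_ _ _ -> _] := ev x y w; have [_ _ _ -> _] := ev X Y W.
  by rewrite expr0 mul1r.
Qed.

(* Doubling leads from the leaf [j] to the leaf [2 j], and the leaf [j = M] of
   2-torsion lies on the plane [x = y]. *)
Lemma flow_algebraic n i (x y w : L) : (i <= n)%N -> flow (2 ^ n) (2 ^ i) x y w ->
  exists G : B, G != 0 /\ feval x y w G = 0.
Proof.
move=> le_in; move mE: (n - i)%N => m; elim: m i le_in mE x y w => [|m IHm] i le_in mE x y w fl.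
  have ei : i = n by lia.
  rewrite ei in fl; have xy := flow_middle (expn_gt0 2 n) fl.
  exists (@Bx k - @By k); split.
    rewrite subr_eq0; apply/eqP => /(congr1 (fun p : B => p`_1)) /eqP.
    by rewrite /Bx /By coefC coefX eq_sym oner_eq0.
  have [ex ey _ _] := bevE (@fps_const k) x y w.
  rewrite /feval; move: (bev _ _ _ _) ex ey => f ex ey.
  by rewrite (rmorphB f) ex ey xy subrr.
have lt_in : (2 ^ i < 2 ^ n)%N by rewrite ltn_exp2l //; lia.
have [X [Y [W [flX dbl]]]] := flow_double (expn_gt0 2 i) lt_in fl.
rewrite -expnS in flX.
have [||G [G0 GX]] := IHm i.+1 _ _ _ _ _ flX; try by lia.
have [e [G' G'E]] := doubled_clear G.
exists G'; split; last by rewrite (G'E _ _ _ _ _ _ dbl) GX mulr0.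
(* To see that [G'] is nonzero, it is evaluated on the leaf 1 of a large level [M], whose double is
   a leaf 2 on which [G] does not vanish. *)
have [N HN] := flow_generic G0 (isT : (0 < 2)%N).
pose M := maxn N 2; have M2 : (1 < M)%N by rewrite leq_max orbT.
have [x' [y' [w' fl']]] : exists x y w : L, flow M 1 x y w.
  by apply: flow_exists => //; lia.
have [X' [Y' [W' [flX' dbl']]]] := flow_double (ltn0Sn 0) M2 fl'.
have := HN M X' Y' W' (leq_maxl _ _) flX'; apply: contra_neq => G'0.
have [d1 d2 d3] := flow_denominators (ltn0Sn 0) M2 fl'.
have := G'E _ _ _ _ _ _ dbl'; rewrite G'0 rmorph0 => /esym/eqP.
by rewrite mulf_eq0 (negbTE (expf_neq0 _ _)) ?mulf_neq0 // => /eqP.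
Qed.

(** The leaf [j = 1] of level [2 ^ N] avoids [f] for large [N], and it is algebraic because [N]
    doublings lead to the middle leaf. *)
Lemma leaf_avoiding (f : B) : f != 0 -> exists h : {rmorphism B -> L},
  [/\ h f != 0, exists G, G != 0 /\ h G = 0 & forall p, h p = 0 -> h (delta p) = 0].
Proof.
move=> f0; have [N HN] := flow_generic f0 (isT : (0 < 1)%N).
have M0 : (0 < 2 ^ N)%N by rewrite expn_gt0.
have [x [y [w fl]]] : exists x y w : L, flow (2 ^ N) 1 x y w by apply: flow_exists => //; lia.
exists (feval x y w); split; first by apply: HN fl; apply/ltnW/ltn_expl.
  exact: (@flow_algebraic N 0).
have [_ [Dx Dy Dw]] := fl; have dd := @fps_derP k (2 ^ N).
by move=> p p0; rewrite (bev_der dd (fps_der_const _) Dx Dy Dw) -/(feval x y w) p0 (der0 dd).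
Qed.

End Leaves.

(** * The Poisson algebra *)

Section Tower.
Variable k : fieldType.
Hypothesis char0 : [pchar k] =i pred0.

(** The structure map starts from [k[w]] because the eigenvalues and cofactors along the tower are
    polynomials in [w]. *)
Record dring := DRing {
  dcar :> idomainType;
  dio : {rmorphism {poly k} -> dcar};
  dder : dcar -> dcar }.

Definition dring_base : dring :=
  @DRing {poly {poly {poly k}}} (polyC \o polyC) (@delta k).

Definition dring_step n (A : dring) : dring :=
  @DRing {poly A} (polyC \o dio A) (der_poly (@dder A) (dio A 'X^n)).

(* The adjoined variables are eigenvectors with the eigenvalues [w^2], [w^3], and
   so on. These are linearly independent of [1 + w] and [1 - w], so that no
   monomial in the new variables contributes a new constant. *)
Fixpoint tower m : dring :=
  if m is m'.+1 then dring_step m'.+2 (tower m') else dring_base.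

Definition diota (A : dring) : {rmorphism k -> A} := dio A \o polyC.

Lemma tower_der m : derivation (@dder (tower m)) /\ forall c, dder (diota (tower m) c) = 0.
Proof.
elim: m => [|m [dD Dc]] /=.
  by split; [exact: delta_der | move=> c; have [_ _ _ dc] := deltaE k; exact: dc].
split; first exact: der_polyP.
by move=> c; rewrite [LHS](der_polyC _ dD) [dder _]Dc polyC0.
Qed.

(** Fractions with logarithmic derivative in [w ^ n k[w]] are constants. Allowing [mu] is what
    carries the induction, since leading terms in a new variable contribute multiples of its
    eigenvalue [w ^ n]. *)
Definition rational_constants n (A : dring) := forall (P Q : A) (mu : {poly k}),
  P != 0 -> Q != 0 -> dder P * Q - P * dder Q = dio A ('X^n * mu) * (P * Q) ->
  mu = 0 /\ exists e, P = diota A e * Q.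

(** The leading coefficients satisfy the relation below with cofactor [w ^ n (w nu + (j - i))],
    which must vanish; so the degrees agree, [nu = 0], and the leading coefficients are
    proportional. Then [P - e Q] cannot be nonzero, as it would again have the degree of [Q]
    although its coefficient there cancels. *)
Lemma rational_constants_step n (A : dring) : derivation (@dder A) ->
  (forall c, dder (diota A c) = 0) ->
  rational_constants n A -> rational_constants n.+1 (dring_step n A).
Proof.
move=> dD Dc ratA P Q mu; set D := @dder (dring_step n A) => P0 Q0 rel.
pose I (c : A) : {poly A} := c%:P.
have dD' : derivation D by apply: der_polyP.
have lead_rel (P1 : {poly A}) (nu : {poly k}) : P1 != 0 ->
    D P1 * Q - P1 * D Q = I (dio A ('X^(n.+1) * nu)) * (P1 * Q) ->
    [/\ size P1 = size Q, nu = 0 & exists e, lead_coef P1 = diota A e * lead_coef Q].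
  move=> P10 rel1; pose i := (size P1).-1; pose j := (size Q).-1.
  have szP : size P1 = i.+1 by rewrite prednK // size_poly_gt0.
  have szQ : size Q = j.+1 by rewrite prednK // size_poly_gt0.
  have szD (R : {poly A}) : (size (D R) <= size R)%N by apply: size_poly.
  have cfD R l : (D R)`_l = dder R`_l + l%:R * dio A 'X^n * R`_l by apply: coef_der_poly.
  have cM (R1 R2 : {poly A}) : (size R1 <= i.+1)%N -> (size R2 <= j.+1)%N ->
      (R1 * R2)`_(i + j) = R1`_i * R2`_j.
    move=> s1 s2; rewrite coefM (bigD1 (inord i)) //= inordK ?ltnS ?leq_addr // addKn.
    rewrite big1 ?addr0 // => l /eqP li; have ll := ltn_ord l.
    have [lt|gt|e] := ltngtP l i.
    - by rewrite [R2`__]nth_default ?mulr0 //; apply: leq_trans s2 _; lia.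
    - by rewrite nth_default ?mul0r //; apply: leq_trans s1 _.
    - by case: li; apply: val_inj; rewrite /= inordK // ltnS leq_addr.
  have := congr1 (fun p : {poly A} => p`_(i + j)) rel1.
  rewrite coefB /I coefCM !cM ?szP ?szQ //; try by rewrite -?szP -?szQ szD.
  rewrite !cfD -/i -/j -[P1`_i]/(lead_coef P1) -[Q`_j]/(lead_coef Q) => lrel.
  have lP : lead_coef P1 != 0 by rewrite lead_coef_eq0.
  have lQ : lead_coef Q != 0 by rewrite lead_coef_eq0.
  have [|mu0 e] := ratA _ _ ('X * nu + (j%:R - i%:R)) lP lQ.
    have -> : 'X^n * ('X * nu + (j%:R - i%:R)) = 'X^(n.+1) * nu + (j%:R - i%:R) * 'X^n.
      by rewrite exprSr; ring.
    rewrite (rmorphD (dio A)) mulrDl -lrel.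
    rewrite (rmorphM (dio A)) (rmorphB (dio A)) !(rmorph_nat (dio A)); ring.
  have : (j%:R - i%:R : k) = 0.
    have := congr1 (coefp 0) mu0; rewrite /coefp coefD coefXM add0r coef0.
    by rewrite coefB -!polyC_natr !coefC.
  move/eqP; rewrite subr_eq0 => /eqP/(natr_inj char0) ji.
  split; last exact: e.
    by rewrite ji.
  by move/eqP: mu0; rewrite ji subrr addr0 mulf_eq0 polyX_eq0 => /eqP.
have [sz mu0 [e eE]] := lead_rel P mu P0 rel; split=> //; exists e.
apply/eqP; rewrite -subr_eq0; apply: contraT => T0.
have DI : D (I (diota A e)) = 0 by rewrite /D /= /I (der_polyC _ dD) Dc polyC0.
have relT : D (P - I (diota A e) * Q) * Q - (P - I (diota A e) * Q) * D Q =
    I (dio A ('X^(n.+1) * 0)) * ((P - I (diota A e) * Q) * Q).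
  rewrite (derB dD') dD'.2 DI mulr0 rmorph0 /I polyC0 !mul0r add0r.
  transitivity (D P * Q - P * D Q); first by ring.
  by rewrite rel mu0 mulr0 rmorph0 mul0r.
have [szT _ _] := lead_rel _ 0 T0 relT.
have : (P - I (diota A e) * Q)`_(size Q).-1 = 0.
  rewrite coefB /I coefCM -{1}sz -[P`__]/(lead_coef P) -[Q`__]/(lead_coef Q) eE.
  by rewrite subrr.
by rewrite -szT -[_`__]/(lead_coef _) => /eqP; rewrite lead_coef_eq0 (negbTE T0).
Qed.

Lemma tower_rational m : rational_constants m.+2 (tower m).
Proof.
elim: m => [|m IHm]; first by move=> P Q mu P0 Q0 /(delta_first_integral char0 P0 Q0).
by have [dD Dc] := tower_der m; apply: rational_constants_step.
Qed.

Lemma dio_eq0 m p : dio (tower m) p = 0 -> p = 0.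
Proof.
elim: m => [|m IHm] /=; last by move/eqP; rewrite polyC_eq0 => /eqP/IHm.
by move/eqP; rewrite !polyC_eq0 => /eqP.
Qed.

Lemma tower_nonconstant m : dder (dio (tower m) 'X) != 0.
Proof.
have [dD _] := tower_der m; apply/eqP => D0.
have w0 : dio (tower m) 'X != 0.
  by apply/eqP => /dio_eq0/eqP; rewrite polyX_eq0.
have [|_ [e]] := @tower_rational m _ 1 0 w0 (oner_neq0 _).
  by rewrite D0 (der1 dD) !mulr0 rmorph0 !mul0r subrr.
rewrite mulr1 => /eqP; rewrite -subr_eq0 -rmorphB => /eqP/dio_eq0/eqP.
by rewrite polyXsubC_eq0.
Qed.

(** A leaf is given by a morphism to a domain; its kernel is a nonzero prime stable under the
    derivation that misses [f]. *)
Definition has_leaves (A : dring) := forall f : A, f != 0 ->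
  exists (L : idomainType) (h : {rmorphism A -> L}),
  [/\ h f != 0, exists G, G != 0 /\ h G = 0 & forall p, h p = 0 -> h (dder p) = 0].

Lemma map_poly_leaf (A : dring) (L : idomainType) (h : {rmorphism A -> L}) :
  derivation (@dder A) -> (forall p, h p = 0 -> h (dder p) = 0) ->
  forall (mu : A) p, map_poly h p = 0 -> map_poly h (der_poly (@dder A) mu p) = 0.
Proof.
move=> dD hD mu p /polyP hp; apply/polyP => i; rewrite coef0 coef_map coef_der_poly //=.
have := hp i; rewrite coef_map coef0 /= => pi.
by rewrite rmorphD !rmorphM pi mulr0 addr0 hD.
Qed.

(** A leaf avoiding the leading coefficient of [f], extended coefficientwise, avoids [f]. *)
Lemma tower_leaves m : has_leaves (tower m).
Proof.
elim: m => [|m IHm] f f0.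
  have [h hP] := leaf_avoiding char0 f0.
  by exists (fps k), h.
have lf : lead_coef (f : {poly tower m}) != 0 by rewrite lead_coef_eq0.
have [L [h [hf [G [G0 hG]] hD]]] := IHm _ lf.
exists {poly L}, (map_poly h); split.
- apply: contra_neq hf => hf; rewrite /lead_coef -coef_map.
  by rewrite [map_poly _ _]hf coef0.
- exists (G%:P); rewrite polyC_eq0; split=> //.
  by rewrite /= map_polyC /= hG polyC0.
- by have [dD _] := tower_der m; apply: map_poly_leaf.
Qed.

Lemma tower_generated m : exists g : 'I_(m + 3) -> tower m,
  forall a, exists p : {mpoly k[m + 3]}, a = mmap (diota (tower m)) g p.
Proof.
elim: m => [|m [g gA]]; last by exists (ext_fun (polyC \o g) 'X); exact: (poly_generated gA).
pose g0 (i : 'I_0) : k := 0.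
have gen0 (a : k) : exists p : {mpoly k[0]}, a = mmap (idfun : {rmorphism k -> k}) g0 p.
  by exists a%:MP; rewrite mmapC.
have gen3 := poly_generated (poly_generated (poly_generated gen0)).
by exists (ext_fun (polyC \o (ext_fun (polyC \o (ext_fun (polyC \o g0) 'X)) 'X)) 'X).
Qed.

Lemma tower_krull_dim m : krull_dim_eq (tower m) (m + 3).
Proof.
split; last by have [g gA] := tower_generated m; apply: krull_dim_ub gA.
elim: m => [|m IHm]; last exact: poly_prime_chain.
do 3!apply: poly_prime_chain.
exists (fun _ x => x = 0); split=> [i _|//]; split.
- by split=> // [x y -> ->|a x ->]; rewrite ?addr0 ?mulr0.
- by apply/eqP; exact: oner_neq0.
- by move=> x y /eqP; rewrite mulf_eq0 => /orP[]/eqP; [left|right].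
Qed.

End Tower.

(** * The bracket and its Poisson primes *)

Section PoissonStructure.

Definition wedge_bracket (A : comNzRingType) (D E : A -> A) (f g : A) :=
  D f * E g - E f * D g.

(** The Jacobi identity holds because [D] and [E] commute. *)
Lemma wedge_bracket_poisson (k : fieldType) (A : idomainType) (iota : {rmorphism k -> A})
    (D E : A -> A) :
  derivation D -> derivation E -> (forall p, D (E p) = E (D p)) ->
  (forall c, D (iota c) = 0) -> (forall c, E (iota c) = 0) ->
  is_poisson_bracket iota (wedge_bracket D E).
Proof.
move=> dD dE DE Dc Ec; rewrite /wedge_bracket.
split; first by move=> x y z; rewrite dD.1 dE.1; ring.
split; first by move=> x y z; rewrite dD.1 dE.1; ring.
split; first by move=> c x y; rewrite dD.2 dE.2 Dc Ec; ring.
split; first by move=> c x y; rewrite dD.2 dE.2 Dc Ec; ring.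
split; first by move=> x; ring.
split; last by move=> x y z; rewrite dD.2 dE.2; ring.
by move=> x y z; rewrite !(derB dD) !(derB dE) !dD.2 !dE.2 !DE; ring.
Qed.

Lemma frac_repr (A : idomainType) (z : {fraction A}) :
  exists a b : A, b != 0 /\ z = FracField.tofrac a / FracField.tofrac b.
Proof.
elim/quotW: z => r; exists (frac r).1, (frac r).2.
have d0 : (frac r).2 != 0 by case: r.
split=> //; have d0' : FracField.tofrac (frac r).2 != 0 by rewrite tofrac_eq0.
apply: (canRL (mulfK d0')).
rewrite -[LHS]/(FracField.mul _ _) !piE; apply/eqmodP; rewrite /= FracField.equivfE /FracField.mulf.
by rewrite !numden_Ratio ?oner_eq0 ?mulf_neq0 ?oner_eq0 // !mulr1 mulrC.
Qed.

Lemma zero_poisson_prime (A : idomainType) (br : A -> A -> A) :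
  (forall a, br 0 a = 0) -> is_poisson_prime br (fun x => x = 0).
Proof.
move=> br0.
have I0 : is_ideal (fun x : A => x = 0).
  by split=> // [x y -> ->|a x ->]; rewrite ?addr0 ?mulr0.
split; last by split=> // x a ->.
split=> //; first by apply/eqP; exact: oner_neq0.
by move=> x y /eqP; rewrite mulf_eq0 => /orP[]/eqP; [left|right].
Qed.

Lemma kernel_poisson_prime (A L : idomainType) (br : A -> A -> A) (h : {rmorphism A -> L}) :
  (forall x a, h x = 0 -> h (br x a) = 0) -> is_poisson_prime br (fun x => h x = 0).
Proof.
move=> hbr.
have I0 : is_ideal (fun x : A => h x = 0).
  split; first exact: rmorph0.
    by move=> x y hx hy; rewrite rmorphD hx hy addr0.
  by move=> a x hx; rewrite rmorphM hx mulr0.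
split; last by split=> // x a; exact: hbr.
split=> //; first by rewrite rmorph1; apply/eqP; exact: oner_neq0.
by move=> x y /eqP; rewrite rmorphM mulf_eq0 => /orP[]/eqP; [left|right].
Qed.

End PoissonStructure.

Theorem theorem8p1 (k : fieldType) (hk : [pchar k] =i pred0) (d : nat)
  (hd : (4 <= d)%N) :
  exists (A : idomainType) (iota : {rmorphism k -> A}) (br : A -> A -> A),
    [/\ finitely_generated iota,
        is_poisson_bracket iota br,
        krull_dim_eq A d,
        zero_poisson_rational iota br
      & ~ poisson_locally_closed br (fun x : A => x = 0)].
Proof.
(* The bound [d >= 4] leaves at least one adjoined variable, the last one, for [E] to act on. *)
pose m := (d - 4)%N; have dE : d = (m.+1 + 3)%N by rewrite /m; lia.
pose A := tower k m.+1; pose iota := diota A.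
pose D : A -> A := @dder k A.
pose E : A -> A := der_poly (fun _ : tower k m => 0) 1.
have [dDm _] := tower_der k m.
have [dD Dc] := tower_der k m.+1.
have dE0 : derivation (fun _ : tower k m => 0 : tower k m) by apply: derivation0.
have dE' : derivation E by apply: der_polyP.
have Ec c : E (iota c) = 0 by rewrite /E /iota /= (der_polyC _ dE0) polyC0.
(* Both derivations act separately on each coefficient in the last variable, [E] by the integer
   scalar [i]. *)
have DE p : D (E p) = E (D p).
  apply/polyP => i; rewrite /D /E /= !coef_der_poly // !add0r !mulr1.
  by rewrite dDm.2 (der_nat dDm); ring.
have EX : E 'X = 'X by rewrite /E (der_polyX _ dE0) scale1r.
have D1 : D 1 = 0 := der1 dD; have E1 : E 1 = 0 := der1 dE'.
have D0 : D 0 = 0 := der0 dD; have E0 : E 0 = 0 := der0 dE'.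
exists A, iota, (wedge_bracket D E); split.
- by have [g gA] := tower_generated k m.+1; exists (m.+1 + 3)%N, g.
- exact: wedge_bracket_poisson.
- by rewrite dE; apply: tower_krull_dim.
- move=> z; have [a [b [b0 zE]]] := frac_repr z.
  pose T : {rmorphism k -> {fraction A}} := @tofrac A \o iota.
  move=> /(_ a b _ _ b0 _ zE) cen.
  (* The quotient rule is read with second argument [c / 1]. *)
  have key c : wedge_bracket D E a c * b = a * wedge_bracket D E b c.
    have := cen c 1 (oner_neq0 _); rewrite /frac_bracket_formula => /eqP.
    rewrite mulf_eq0 invr_eq0 !tofrac_eq0 mulf_eq0 !expf_eq0 (negbTE b0) oner_eq0 !andbF orbF.
    rewrite /wedge_bracket D1 E1 !mulr0 subrr !mulr0 !subr0 !mulr1 subr_eq0.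
    by rewrite orbF => /eqP.
  have [a0|a0] := eqVneq a 0.
    exists 'X; rewrite polyX_eq0; split=> //.
    by rewrite -[map_poly _ _]/(map_poly T _) map_polyX hornerX zE a0 rmorph0 mul0r.
  pose w : A := dio A 'X.
  have Ew : E w = 0 by rewrite /E /w /= (der_polyC _ dE0) polyC0.
  have Dw : D w != 0 := tower_nonconstant hk m.+1.
  (* Since [E w = 0] and [D w] is nonzero, bracketing with [w] shows that [E] kills [a / b]. *)
  have eqE : E a * b = a * E b.
    apply: (mulIf Dw); have := key w; rewrite /wedge_bracket Ew !mulr0 !sub0r.
    by rewrite mulNr mulrN => /oppr_inj; rewrite mulrAC -mulrA => ->; ring.
  (* Bracketing with the last variable, on which [E] is the identity, now shows that [D] kills
     [a / b] as well. *)
  have eqD : D a * b - a * D b = dio A ('X^(m.+3) * 0) * (a * b).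
    have X0 : ('X : A) != 0 := negbT (polyX_eq0 (tower k m)).
    rewrite mulr0 rmorph0 mul0r; apply: (mulIf X0); rewrite mul0r.
    have := key 'X; rewrite /wedge_bracket EX => e.
    transitivity ((D a * 'X - E a * D 'X) * b - a * (D b * 'X - E b * D 'X) +
      D 'X * (E a * b - a * E b)); first by ring.
    by rewrite e eqE !subrr mulr0 addr0.
  have [_ [e aE]] := tower_rational hk a0 b0 eqD.
  exists ('X - e%:P); rewrite polyXsubC_eq0; split=> //.
  rewrite -[map_poly _ _]/(map_poly T _) rmorphB /= map_polyX map_polyC /=.
  rewrite hornerD hornerN hornerX hornerC zE aE (rmorphM (@tofrac A)) mulfK ?subrr //.
  by rewrite tofrac_eq0.
- have br0 a : wedge_bracket D E 0 a = 0.
    by rewrite /wedge_bracket D0 E0 !mul0r subrr.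
  (* The zero ideal lies in the locally closed set, so [S] is contained in 0 and [T] has a nonzero
     element [f]. A nonzero Poisson prime missing [f] lies in the same set, a contradiction. *)
  case=> S [T ST]; have [/(_ (fun x => conj id id))[S0 T0] _] := ST _ (zero_poisson_prime br0).
  have [f Tf f0] : exists2 f, T f & f != 0.
    apply: contrapT => nf; apply: T0 => x Tx; apply/eqP/negPn/negP => x0; apply: nf.
    by exists x.
  (* The leaf is taken in the coefficient ring and extended coefficientwise, so that its kernel is
     stable under [E] too. *)
  have lf : lead_coef (f : {poly tower k m}) != 0 by rewrite lead_coef_eq0.
  have [L [h [hf [G [G0 hG]] hD]]] := tower_leaves hk lf.
  pose H : {rmorphism A -> {poly L}} := map_poly h.
  have Hbr x a : H x = 0 -> H (wedge_bracket D E x a) = 0.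
    move=> Hx; rewrite rmorphB !rmorphM.
    have -> : H (D x) = 0 by apply: map_poly_leaf.
    have -> : H (E x) = 0.
      apply/polyP => i; rewrite /H /= coef_map /E coef_der_poly //= add0r.
      have := congr1 (fun p : {poly L} => p`_i) Hx; rewrite /H /= coef_map coef0 /= => xi.
      by rewrite !rmorphM xi mulr0.
    by rewrite !mul0r subrr.
  have [_ HQ] := ST _ (kernel_poisson_prime Hbr).
  have /(_ (G%:P))[H1 _] : same_set (fun x => H x = 0) (fun x => x = 0).
    apply: HQ; split=> [x /S0 ->|TH]; first exact: rmorph0.
    move/eqP: hf; apply; have := TH _ Tf.
    rewrite /H /= => /polyP/(_ (size (f : {poly tower k m})).-1).
    by rewrite coef_map coef0.
  have : G%:P = 0 :> {poly tower k m} by apply: H1; rewrite /H /= map_polyC /= hG polyC0.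
  by move/eqP; rewrite polyC_eq0 (negbTE G0).
Qed.
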